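(* Let $g=0$ and let $q\in\mathbb R^+$ be arbitrary. Let $u_h^0\in V_h$ and let $u_h^1,\dots,u_h^N\in V_h$ solve the backward Euler Galerkin discretization stabilized with the graph-Laplacian operator with coefficients $\tilde\nu_{ij}$, $$\sum_{j\in\mathcal N_h(\Omega_i)}\mathsf M_{ij}\frac{u_j^{n+1}-u_j^n}{\Delta t}+\sum_{j\in\mathcal N_h(\Omega_i)}\big(\mathsf F_{ij}(u_h^{n+1})+\tilde\nu_{ij}(u_h^{n+1})\,\ell(i,j)\big)u_j^{n+1}=0$$ for every node $i$ not on the inflow boundary, with the nodal values on the inflow boundary prescribed. Then the solution satisfies the global DMP: for every $n=1,\dots,N$ and $\boldsymbol x\in\Omega$, $$\min_{(\boldsymbol y,\bar t)\in\Gamma}u_h(\boldsymbol y,\bar t)\le u_h^n(\boldsymbol x)\le\max_{(\boldsymbol y,\bar t)\in\Gamma}u_h(\boldsymbol y,\bar t),\qquad \Gamma=\Omega\times\{0\}\cup\Gamma_{\rm in},$$ where the minimum and maximum are over the values of $u_h^0$ in $\Omega$ and the prescribed inflow boundary values at $t^1,\dots,t^N$.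
   Context: $\Omega\subset\mathbb R^d$ is a bounded domain and $\mathcal T_h$ a conforming mesh of $\Omega$ (triangles/quadrilaterals for $d=2$, tetrahedra/hexahedra for $d=3$) with set of nodes $\mathcal N_h$; node $i$ has position $\boldsymbol x_i$. $\Omega_i$ is the union of the elements having $i$ as a node, and $\mathcal N_h(\Omega_i)$ is the set of nodes in $\Omega_i$ (including $i$). $V_h$ is the continuous $P_1$ (or $Q_1$ on quadrilaterals/hexahedra) finite element space with nodal basis $\{\varphi_i\}$, and $u_h=\sum_i u_i\varphi_i$. $(\cdot,\cdot)$ is the $L^2(\Omega)$ inner product; $\boldsymbol f\in\mathrm{Lip}(\mathbb R;\mathbb R^d)$ is the flux of the conservation law $\partial_tu+\nabla\cdot\boldsymbol f(u)=g$; $\Gamma_{\rm in}\subset\partial\Omega\times(0,T]$ is the inflow boundary, on which $u$ is prescribed; $0=t^0<\dots<t^N=T$ and $\Delta t$ is the time step. $\mathsf M_{ij}=(\varphi_j,\varphi_i)$ (consistent mass matrix), $\mathsf F_{ij}(w_h)=(\boldsymbol f'(w_h)\cdot\nabla\varphi_j,\varphi_i)$, $\ell(i,j)=2\delta_{ij}-1$. Shock detector: for $j\in\mathcal N_h(\Omega_i)\setminus\{i\}$ let $\boldsymbol r_{ij}=\boldsymbol x_j-\boldsymbol x_i$; let $\boldsymbol x_{ij}^{\rm sym}$ be the intersection, other than $\boldsymbol x_j$, of $\partial\Omega_i$ with the line through $\boldsymbol x_i,\boldsymbol x_j$ (the point where the ray from $\boldsymbol x_i$ in direction $-\boldsymbol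 r_{ij}$ leaves $\Omega_i$); $\boldsymbol r_{ij}^{\rm sym}=\boldsymbol x_{ij}^{\rm sym}-\boldsymbol x_i$, $u_j^{\rm sym}=u_h(\boldsymbol x_{ij}^{\rm sym})$. Set $$J_{ij}=\frac{u_j-u_i}{|\boldsymbol r_{ij}|}+\frac{u_j^{\rm sym}-u_i}{|\boldsymbol r_{ij}^{\rm sym}|},\qquad A_{ij}=\frac12\Big(\frac{|u_j-u_i|}{|\boldsymbol r_{ij}|}+\frac{|u_j^{\rm sym}-u_i|}{|\boldsymbol r_{ij}^{\rm sym}|}\Big),$$ (terms with $\boldsymbol r_{ij}^{\rm sym}=0$, possible only at boundary nodes, are dropped), and, with sums over $j\in\mathcal N_h(\Omega_i)\setminus\{i\}$, $$\alpha_i(u_h)=\Big[\frac{|\sum_j J_{ij}|}{\sum_j 2A_{ij}}\Big]^q\ \text{ if }\sum_jA_{ij}\neq0,\qquad \alpha_i(u_h)=0\ \text{ otherwise.}$$ Artificial diffusion: for $i\ne j$, $$\nu_{ij}(w_h)=\max\{\alpha_i(w_h)\mathsf F_{ij}(w_h),\alpha_j(w_h)\mathsf F_{ji}(w_h),0\},\qquad \tilde\nu_{ij}(w_h)=\nu_{ij}(w_h)+\frac1{\Delta t}\max\{\alpha_i(w_h)\mathsf M_{ij},0,\alpha_j(w_h)\mathsf M_{ji}\},$$ and $\tilde\nu_{ii}=\sum_{j\in\mathcal N_h(\Omega_i),j\ne i}\tilde\nu_{ij}$. *)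

(* Defs.v *)
From HB Require Import structures.
From mathcomp Require Import all_boot all_order all_algebra.
From mathcomp Require Import all_classical all_reals all_analysis.

Set Implicit Arguments.
Unset Strict Implicit.
Unset Printing Implicit Defensive.

Import Order.TTheory GRing.Theory Num.Theory.
Import numFieldNormedType.Exports.

Local Open Scope classical_set_scope.
Local Open Scope ring_scope.

(* The norm that the library puts on 'rV[R]_d is the sup norm. *)
Definition enorm (R : realType) (d : nat) (v : 'rV[R]_d) : R :=
  Num.sqrt (\sum_(k < d) v 0 k ^+ 2).

(* Lebesgue measure on R^d is built on d.-tuple R, which carries the product
   sigma-algebra, as the d-fold product of the one-dimensional measure. *)

Section lebesgue_tuple.
Variable R : realType.
Notation M := (measurableTypeR R).

Section step.
Variables (n : nat) (m : {sigma_finite_measure set (n.-tuple M) -> \bar R}).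

Definition cons_pair (p : M * n.-tuple M) : n.+1.-tuple M := [tuple of p.1 :: p.2].

Definition uncons (t : n.+1.-tuple M) : M * n.-tuple M :=
  (thead t, [tuple of behead t]).

Lemma measurable_cons_pair : measurable_fun setT cons_pair.
Proof. exact: measurable_cons. Qed.

Lemma measurable_uncons : measurable_fun setT uncons.
Proof.
apply/measurable_fun_pairP; split; first exact: measurable_tnth.
exact: measurable_behead.
Qed.

Lemma cons_pairK : cancel cons_pair uncons.
Proof. by case=> x t; congr pair; apply/val_inj. Qed.

Definition lebesgue_step : set (n.+1.-tuple M) -> \bar R :=
  pushforward (@lebesgue_measure R \x m)%E cons_pair.

Let step0 : lebesgue_step set0 = 0%E.
Proof. by rewrite /lebesgue_step /pushforward preimage_set0 measure0. Qed.

Let step_ge0 A : (0 <= lebesgue_step A)%E.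
Proof. by apply: integral_ge0 => x _; exact: measure_ge0. Qed.

Let step_sigma_additive : semi_sigma_additive lebesgue_step.
Proof.
have mc A : measurable A -> measurable (cons_pair @^-1` A).
  by move=> mA; rewrite -[X in measurable X]setTI; exact: measurable_cons_pair.
move=> F mF tF mUF; rewrite /lebesgue_step /pushforward preimage_bigcup.
apply: measure_semi_sigma_additive.
- by move=> k; exact: mc.
- apply/trivIsetP => i j _ _ ij; rewrite -preimage_setI.
  by move/trivIsetP : tF => /(_ _ _ _ _ ij) ->//; rewrite preimage_set0.
- by rewrite -preimage_bigcup; exact: mc.
Qed.

HB.instance Definition _ := isMeasure.Build _ _ _ lebesgue_step
  step0 step_ge0 step_sigma_additive.

Lemma lebesgue_step_sigma_finite : sigma_finite setT lebesgue_step.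
Proof.
pose l := @lebesgue_measure R.
have [F FT Foo] : sigma_finite setT (l \x m)%E.
  have /sigma_finiteP[F [TF ndF Foo]] := sigma_finiteT l.
  have /sigma_finiteP[G [TG ndG Goo]] := sigma_finiteT m.
  exists (fun k => F k `*` G k).
    rewrite -setXTT TF TG predeqE => -[x y]; split.
      move=> [/= [i _ Fix] [j _ Gjy]]; exists (maxn i j) => //; split.
      - by move: x Fix; exact/subsetPset/ndF/leq_maxl.
      - by move: y Gjy; exact/subsetPset/ndG/leq_maxr.
    by move=> [i _ []/= ? ?]; split; exists i.
  move=> k; have [mF Fk] := Foo k; have [mG Gk] := Goo k.
  split; first exact: measurableX.
  by rewrite product_measure1E// lte_mul_pinfty// ge0_fin_numE.
exists (fun k => uncons @^-1` F k).
  by rewrite -preimage_bigcup -FT preimage_setT.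
move=> k; have [mF Fk] := Foo k; split.
  by rewrite -[X in measurable X]setTI; exact: measurable_uncons.
rewrite /lebesgue_step /pushforward -comp_preimage.
by rewrite (_ : uncons \o cons_pair = id) //; apply/funext/cons_pairK.
Qed.

HB.instance Definition _ := Measure_isSigmaFinite.Build _ _ _ lebesgue_step
  lebesgue_step_sigma_finite.

End step.

Fixpoint lebesgue_tuple (n : nat) : {sigma_finite_measure set (n.-tuple M) -> \bar R} :=
  if n is k.+1 then lebesgue_step (lebesgue_tuple k) else \d_([tuple]).

End lebesgue_tuple.

Definition integral_Rd (R : realType) (d : nat) (D : set 'rV[R]_d) (g : 'rV[R]_d -> R) : R :=
  let vec (t : d.-tuple (measurableTypeR R)) : 'rV[R]_d := \row_k tnth t k in
  (\int[lebesgue_tuple R d]_(t in vec @^-1` D) g (vec t))%R.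

(* Triangle / tetrahedron, resp. quadrilateral / hexahedron. *)
Inductive cell_shape := Simplex | Cube.

Definition ref_vertex (d : nat) (s : cell_shape) : finType :=
  match s with Simplex => 'I_d.+1 | Cube => {ffun 'I_d -> bool} end.

Section reference.
Variables (R : realType) (d : nat).
Implicit Types (x : 'rV[R]_d) (s : cell_shape).

Definition ref_cell s : set 'rV[R]_d :=
  match s with
  | Simplex => [set x | (forall k, 0 <= x 0 k) /\ \sum_k x 0 k <= 1]
  | Cube => [set x | forall k, 0 <= x 0 k <= 1]
  end.

Definition ref_point s : ref_vertex d s -> 'rV[R]_d :=
  match s with
  | Simplex => fun a => if unlift ord0 a is Some k then delta_mx 0 k else 0
  | Cube => fun b => \row_k (b k)%:R
  end.

(* Barycentric coordinates, resp. multilinear nodal functions on [0,1]^d. *)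
Definition shape_fun s : ref_vertex d s -> 'rV[R]_d -> R :=
  match s with
  | Simplex => fun a x => if unlift ord0 a is Some k then x 0 k else 1 - \sum_k x 0 k
  | Cube => fun b x => \prod_k (if b k then x 0 k else 1 - x 0 k)
  end.

(* Faces of all dimensions of a convex polytope, the empty one and the
   polytope itself included. *)
Definition is_face (P F : set 'rV[R]_d) : Prop :=
  [/\ F `<=` P,
      convex_set (F : set (convex_lmodType 'rV[R]_d)) &
      forall x y l, P x -> P y -> 0 < l < 1 ->
        F (l *: x + (1 - l) *: y) -> F x /\ F y].

End reference.
Arguments ref_cell R d s : clear implicits.
Arguments ref_point R {d s} a.
Arguments shape_fun {R d s} a x.

Record mesh (R : realType) (d : nat) := Mesh {
  node : finType;
  pos : node -> 'rV[R]_d;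
  elt : finType;
  shp : elt -> cell_shape;
  vtx : forall K : elt, ref_vertex d (shp K) -> node }.

Section mesh_theory.
Variables (R : realType) (d : nat) (T : mesh R d).
Implicit Types (i j : node T) (K : elt T) (v : 'rV[R]_d -> R).

(* The affine, resp. multilinear, map sending the reference vertices to the
   vertices of K. *)
Definition geo K (xh : 'rV[R]_d) : 'rV[R]_d :=
  \sum_(a : ref_vertex d (shp K)) shape_fun a xh *: pos (vtx a).

Definition cell K : set 'rV[R]_d := geo K @` ref_cell R d (shp K).

Definition is_vertex K i : Prop := exists a : ref_vertex d (shp K), vtx a = i.

(* [geo K] is a diffeomorphism of the (closed) reference element onto [K]. *)
Definition valid_element K : Prop :=
  [/\ injective (@vtx _ _ T K),
      {in ref_cell R d (shp K) &, injective (geo K)} &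
      forall xh, ref_cell R d (shp K) xh -> \det ('J (geo K) xh) != 0].

(* The intersection is empty or a common vertex, edge or face, with the same
   nodes seen from both sides. *)
Definition match_elements K K' : Prop :=
  exists F F' : set 'rV[R]_d,
    [/\ is_face (ref_cell R d (shp K)) F /\ is_face (ref_cell R d (shp K')) F',
        F <> ref_cell R d (shp K) /\ F' <> ref_cell R d (shp K'),
        cell K `&` cell K' = geo K @` F,
        cell K `&` cell K' = geo K' @` F' &
        forall i, (exists2 a : ref_vertex d (shp K), F (ref_point R a) & vtx a = i) <->
          (exists2 a : ref_vertex d (shp K'), F' (ref_point R a) & vtx a = i)].

Definition conforming_mesh (Omega : set 'rV[R]_d) : Prop :=
  [/\ injective (@pos _ _ T) /\ (forall i, exists K, is_vertex K i),
      forall K, valid_element K,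
      forall K K', K <> K' -> match_elements K K' &
      \bigcup_K cell K = closure Omega].

(* [patch i] is Omega_i and [nbr i] is N_h(Omega_i). *)
Definition patch i : set 'rV[R]_d :=
  [set x | exists2 K, is_vertex K i & cell K x].

Definition nbr i : {set node T} := [set j | `[< patch i (pos j) >]]%SET.

(* Only the values of the functions on the closure of Omega matter. *)
Definition fe_space (Omega : set 'rV[R]_d) v : Prop :=
  {within closure Omega, continuous v} /\
  forall K, exists c : ref_vertex d (shp K) -> R,
    forall xh, ref_cell R d (shp K) xh -> v (geo K xh) = \sum_a c a * shape_fun a xh.

Definition nodal_basis (Omega : set 'rV[R]_d) (phi : node T -> 'rV[R]_d -> R) : Prop :=
  (forall j, fe_space Omega (phi j)) /\
  (forall i j, phi j (pos i) = (i == j)%:R).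

(* The point where the ray from x_i in the direction - r_ij leaves Omega_i
   for the first time. *)
Definition sym_point i j : 'rV[R]_d :=
  let r := pos j - pos i in
  pos i - sup [set s : R | 0 <= s /\
    forall s', 0 <= s' <= s -> patch i (pos i - s' *: r)] *: r.

(* When r_ij^sym = 0 the second quotient of J and of A is 0 / 0 = 0. *)
Definition Jump v i j : R :=
  (v (pos j) - v (pos i)) / enorm (pos j - pos i) +
  (v (sym_point i j) - v (pos i)) / enorm (sym_point i j - pos i).

Definition Avg v i j : R :=
  2^-1 * (`|v (pos j) - v (pos i)| / enorm (pos j - pos i) +
          `|v (sym_point i j) - v (pos i)| / enorm (sym_point i j - pos i)).

Definition alpha (q : R) v i : R :=
  if \sum_(j in nbr i | j != i) Avg v i j != 0
  then (`|\sum_(j in nbr i | j != i) Jump v i j| /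
        \sum_(j in nbr i | j != i) 2 * Avg v i j) `^ q
  else 0.

Section scheme.
Variables (Omega : set 'rV[R]_d) (phi : node T -> 'rV[R]_d -> R).
Variables (df : R -> 'rV[R]_d) (q : R).

(* The classical gradient; it exists at every point of Omega outside of the
   element boundaries, which form a null set. *)
Definition grad v (x : 'rV[R]_d) : 'rV[R]_d := \row_k 'D_(delta_mx 0 k) v x.

Definition mass i j : R := integral_Rd Omega (fun x => phi j x * phi i x).

Definition transport v i j : R :=
  integral_Rd Omega (fun x => (\sum_k df (v x) 0 k * grad (phi j) x 0 k) * phi i x).

Definition ell i j : R := 2 * (i == j)%:R - 1.

Definition nu v i j : R :=
  Num.max (Num.max (alpha q v i * transport v i j) (alpha q v j * transport v j i)) 0.

Definition nut_off (dt : R) v i j : R :=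
  nu v i j +
  dt^-1 * Num.max (Num.max (alpha q v i * mass i j) 0) (alpha q v j * mass j i).

Definition nut (dt : R) v i j : R :=
  if i == j then \sum_(k in nbr i | k != i) nut_off dt v i k else nut_off dt v i j.

Definition scheme_residual (dt : R) (v0 v1 : 'rV[R]_d -> R) i : R :=
  \sum_(j in nbr i) mass i j * ((v1 (pos j) - v0 (pos j)) / dt) +
  \sum_(j in nbr i) (transport v1 i j + nut dt v1 i j * ell i j) * v1 (pos j).

End scheme.
End mesh_theory.

(* A Lipschitz flux is differentiable only almost everywhere: [df] is any Borel
   representative of its (essentially bounded) derivative. *)
Definition flux_derivative (R : realType) (d : nat) (f df : R -> 'rV[R]_d) : Prop :=
  [/\ forall s, derivable f s 1 -> df s = derive1 f s,
      forall k, measurable_fun [set: R] (fun s => df s 0 k) &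
      exists C, forall s, `|df s| <= C].

(* The values of u_h on Omega x {0} and on the part of the inflow boundary
   at the times t^1, ..., t^N. *)
Definition Gamma_values (R : realType) (d N : nat) (Omega : set 'rV[R]_d)
    (Gin : set ('rV[R]_d * R)) (t : nat -> R) (u : nat -> 'rV[R]_d -> R) : set R :=
  [set r | (exists2 y, Omega y & r = u 0%N y) \/
    exists n y, [/\ (1 <= n <= N)%N, Gin (y, t n) & r = u n y]].

(* Main.v *)
Require Import Defs.
From HB Require Import structures.
From mathcomp Require Import all_boot all_order all_algebra.
From mathcomp Require Import all_classical all_reals all_analysis.
From mathcomp Require Import measurable_realfun ring lra.
Import Order.TTheory GRing.Theory Num.Theory.
Import numFieldNormedType.Exports.
Set Implicit Arguments.
Unset Strict Implicit.
Unset Printing Implicit Defensive.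
Local Open Scope classical_set_scope.
Local Open Scope ring_scope.

(** Let v be the solution at a new time, w the one at the previous time, and i a node
where v is largest. If i is not an inflow node, it satisfies the scheme. At a maximum
all the jumps of the shock detector have one sign, so the detector is 1, unless v is
constant on the neighbours of i ([alpha_at_max]); in the first case the diffusion
coefficient dominates F_ij + M_ij / dt, where F is the transport and M the mass matrix.
Since the rows of F sum to zero, the scheme at i reads
[sum_j M_ij (v_i - w_j) / dt + sum_(j != i) (nu_ij - F_ij - M_ij / dt) (v_i - v_j) = 0]
([graph_laplacian_identity]), and the second sum is nonnegative. As M_ij >= 0 and
M_ii > 0, v_i cannot exceed the maximum of w ([step_max]). Induction over the time
steps gives the upper bound ([global_max]), and the change of sign of [residualN] turns
it into the lower bound. Values at the nodes control all others, the shape functions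
being a partition of unity with nonnegative members.

The analytic content is the identity sum_j F_ij = 0 ([transport_sum0]). Where phi_i
does not vanish, the basis functions of the neighbours of i sum to one, and inside a cell
they are differentiable, so their gradients cancel. The integral of the sum is the sum
of the integrals as soon as the skeleton of the mesh is a null set and each
integrand is bounded and measurable outside of it.

Everything about a cell rests on one property of the shape functions of both
kinds of cells: they are affine in each variable. Hence increments have an exact
expression ([multiaffine_increment]), in which the geometric map appears through a
matrix that extends the Jacobian continuously off the diagonal. By compactness a
valid geometric map expands distances ([geo_expand]); so the finite element functions
are Lipschitz and differentiable inside a cell ([cell_derivable]). The skeleton lies in
Lipschitz images of finitely many pieces of hyperplanes, which n^(d-1) cubes of side 1/n
cover ([content0_bd_piece]). *)

(** * Multiaffine functions *)

Section Multiaffine.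
Variables (R : realType) (d : nat).
Implicit Types (x y z : 'rV[R]_d) (k l : 'I_d) (f g : 'rV[R]_d -> R).

Definition upd x k (s : R) : 'rV[R]_d := \row_l (if l == k then s else x 0 l).

(** Affine in each variable separately. Barycentric coordinates and multilinear
nodal functions are both of this kind, which allows one treatment of all cells. *)
Definition multiaffine f : Prop :=
  forall x k s, f (upd x k s) = (1 - s) * f (upd x k 0) + s * f (upd x k 1).

(** The partial derivative along the k-th axis: the difference over a unit step is
exact for a function that is affine in this variable. *)
Definition slope f k x : R := f (upd x k 1) - f (upd x k 0).

(** The vertices of the staircase path from x to y that changes one coordinate at
a time. *)
Definition mix x y (n : nat) : 'rV[R]_d :=
  \row_l (if (l < n)%N then y 0 l else x 0 l).

Lemma mix0 x y : mix x y 0 = x.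
Proof. by apply/rowP => l; rewrite mxE. Qed.

Lemma mix_full x y : mix x y d = y.
Proof. by apply/rowP => l; rewrite mxE ltn_ord. Qed.

Lemma mix_same x n : mix x x n = x.
Proof. by apply/rowP => l; rewrite mxE if_same. Qed.

Lemma mix_updl x y k : upd (mix x y k) k (x 0 k) = mix x y k.
Proof.
by apply/rowP => l; rewrite !mxE; case: eqP => [->|//]; rewrite ltnn.
Qed.

Lemma mix_updr x y k : upd (mix x y k) k (y 0 k) = mix x y k.+1.
Proof.
apply/rowP => l; rewrite !mxE; case: eqP => [->|/eqP nlk]; first by rewrite ltnSn.
by rewrite [(l < k.+1)%N]ltnS [(l <= k)%N]leq_eqVlt val_eqE (negbTE nlk).
Qed.

(** Each step of the staircase path is parallel to an axis, where f is affine. *)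
Lemma multiaffine_increment f x y : multiaffine f ->
  f x - f y = \sum_k (x 0 k - y 0 k) * slope f k (mix x y k).
Proof.
move=> mf.
have step k : f (mix x y k) - f (mix x y k.+1) =
    (x 0 k - y 0 k) * slope f k (mix x y k).
  rewrite -{1}(mix_updl x y k) -mix_updr mf [X in _ - X]mf /slope; ring.
rewrite -(eq_bigr _ (fun k _ => step k)).
rewrite -(big_mkord xpredT (fun n => f (mix x y n) - f (mix x y n.+1))).
rewrite (@telescope_sumr_eq _ 0 d (fun n => - f (mix x y n)))//.
  by rewrite mix0 mix_full opprK addrC.
by move=> n _; rewrite opprK addrC.
Qed.

Lemma multiaffine_sum (I : finType) (c : I -> R) (F : I -> 'rV[R]_d -> R) :
  (forall a, multiaffine (F a)) -> multiaffine (fun x => \sum_a c a * F a x).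
Proof.
move=> mF x k s /=; rewrite !mulr_sumr -big_split/=; apply: eq_bigr => a _.
by rewrite mF; ring.
Qed.

End Multiaffine.

(** * Topology of spaces of row vectors *)

Section ContinuityRow.
Variables (R : realType).

Lemma continuous_row (T : topologicalType) d (F : T -> 'rV[R]_d) :
  (forall l, continuous (fun x => F x 0 l)) -> continuous F.
Proof.
move=> cF x; apply/cvgrPdist_lt => e e0.
have : \forall y \near x, forall l, `|F x 0 l - F y 0 l| < e.
  by apply: filter_forall => l; have /cvgrPdist_lt/(_ _ e0) := cF l x.
apply: filterS => y ye; rewrite [`|_|]mx_normrE; apply/bigmax_ltP.
by split=> //= -[i j] _ /=; rewrite (ord1 i) !mxE.
Qed.

Lemma continuous_compfun (T U W : topologicalType) (F : T -> U) (g : U -> W) :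
  continuous F -> continuous g -> continuous (fun x => g (F x)).
Proof. by move=> cF cg x; apply: continuous_comp; [exact: cF|exact: cg]. Qed.

Lemma continuous_pairing (T U W : topologicalType) (F : T -> U) (G : T -> W) :
  continuous F -> continuous G -> continuous (fun x => (F x, G x)).
Proof. by move=> cF cG x; apply: cvg_pair; [exact: cF|exact: cG]. Qed.

Lemma continuous_subr (T : topologicalType) (F G : T -> R) :
  continuous F -> continuous G -> continuous (fun x => F x - G x).
Proof. by move=> cF cG x; apply: cvgB; [exact: cF|exact: cG]. Qed.

Lemma continuous_mulr (T : topologicalType) (F G : T -> R) :
  continuous F -> continuous G -> continuous (fun x => F x * G x).
Proof. by move=> cF cG x; apply: cvgM; [exact: cF|exact: cG]. Qed.

Lemma continuous_sumr (T : topologicalType) (I : finType) (F : I -> T -> R) :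
  (forall a, continuous (F a)) -> continuous (fun x => \sum_a F a x).
Proof.
move=> cF x; apply: cvg_big => //; first exact: add_continuous.
by move=> a _; exact: cF.
Qed.

Lemma continuous_prodr (T : topologicalType) (I : finType) (F : I -> T -> R) :
  (forall a, continuous (F a)) -> continuous (fun x => \prod_a F a x).
Proof.
move=> cF x; apply: cvg_big => //; first exact: mul_continuous.
by move=> a _; exact: cF.
Qed.

Lemma near_forall (T : topologicalType) (I : finType) (P : I -> set T) (x : T) :
  (forall a, \forall y \near x, P a y) -> \forall y \near x, forall a, P a y.
Proof. exact: filter_forall. Qed.

Lemma nbhs_all (T : topologicalType) (x : T) (P : set T) :
  (forall y, P y) -> nbhs x P.
Proof. by move=> hP; apply: nearW. Qed.

Lemma differentiable_bigsum (V W : normedModType R) (I : Type) (r : seq I)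
  (F : I -> V -> W) (x : V) : (forall a, differentiable (F a) x) ->
  differentiable (fun y => \sum_(a <- r) F a y) x.
Proof.
move=> dF; elim: r => [|a r IH].
  by under eq_fun do rewrite big_nil; exact: differentiable_cst.
by under eq_fun do rewrite big_cons; exact: differentiableD.
Qed.

Lemma differentiable_bigprod (V : normedModType R) (I : Type) (r : seq I)
  (F : I -> V -> R) (x : V) : (forall a, differentiable (F a) x) ->
  differentiable (fun y => \prod_(a <- r) F a y) x.
Proof.
move=> dF; elim: r => [|a r IH].
  by under eq_fun do rewrite big_nil; exact: differentiable_cst.
by under eq_fun do rewrite big_cons; exact: differentiableM.
Qed.

Lemma row_norm_le d (v : 'rV[R]_d) (c : R) : 0 <= c ->
  (`|v| <= c) <-> (forall k, `|v 0 k| <= c).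
Proof.
move=> c0; rewrite [`|_|]mx_normrE; split=> [/bigmax_leP[_ h] k|h].
  exact: (h (ord0, k)).
by apply/bigmax_leP; split=> // -[i j] _ /=; rewrite (ord1 i).
Qed.

Lemma coord_norm_le d (v : 'rV[R]_d) k : `|v 0 k| <= `|v|.
Proof. by have /row_norm_le := lexx `|v|; apply. Qed.

Lemma shift_continuous (V : normedModType R) (c : V) :
  continuous (fun x => c + x).
Proof. by move=> x; apply: cvgD; [exact: cvg_cst|exact: cvg_id]. Qed.

Lemma line_continuous d (w x : 'rV[R]_d) :
  continuous (fun h : R => h *: w + x).
Proof.
move=> h; apply: cvgD; last exact: cvg_cst.
by apply: cvgZr_tmp; exact: cvg_id.
Qed.

Lemma line_dnbhs d (w x : 'rV[R]_d) (A : set 'rV[R]_d) :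
  nbhs x A -> \forall h \near (0 : R)^', A (h *: w + x).
Proof.
move=> xA.
have cl : (fun h : R => h *: w + x) @ (0 : R) --> 0 *: w + x.
  exact: line_continuous.
rewrite scale0r add0r in cl.
by apply: (@nbhs_dnbhs _ (0 : R)); exact: cl.
Qed.

Lemma upd_continuous d k s : continuous (fun x : 'rV[R]_d => upd x k s).
Proof.
apply: continuous_row => l x; under eq_fun do rewrite mxE.
by case: eqP => _; [exact: cst_continuous|exact: coord_continuous].
Qed.

Lemma slope_continuous d (f : 'rV[R]_d -> R) k :
  continuous f -> continuous (slope f k).
Proof.
by move=> cf; apply: continuous_subr;
  exact: (continuous_compfun (@upd_continuous _ _ _)).
Qed.

Lemma mix_continuous d n :
  continuous (fun p : 'rV[R]_d * 'rV[R]_d => mix p.1 p.2 n).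
Proof.
apply: continuous_row => l; under eq_fun do rewrite mxE.
have [_|_] := ltnP l n.
  apply: (@continuous_compfun _ _ _ snd (fun v : 'rV[R]_d => v 0 l)).
    by move=> q; exact: cvg_snd.
  exact: coord_continuous.
apply: (@continuous_compfun _ _ _ fst (fun v : 'rV[R]_d => v 0 l)).
  by move=> q; exact: cvg_fst.
exact: coord_continuous.
Qed.

End ContinuityRow.

(** * Reference cells and their shape functions *)

Section Reference.
Variables (R : realType) (d : nat) (s : cell_shape).
Implicit Types (a b : ref_vertex d s) (x : 'rV[R]_d).

Lemma shape_continuous a : continuous (shape_fun (R:=R) a).
Proof.
case: s a => /= a.
  case: unlift => [k|]; first exact: coord_continuous.
  apply: continuous_subr; first exact: cst_continuous.
  by apply: continuous_sumr => k; exact: coord_continuous.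
apply: continuous_prodr => k; case: (a k); first exact: coord_continuous.
apply: continuous_subr; [exact: cst_continuous|exact: coord_continuous].
Qed.

Lemma shape_differentiable a x :
  differentiable (shape_fun (R:=R) a) x.
Proof.
have dc k : differentiable (fun y : 'rV[R]_d => y 0 k) x.
  exact: differentiable_coord.
case: s a => /= a.
  case: unlift => [k|]; first exact: dc.
  apply: differentiableB; first exact: differentiable_cst.
  exact: differentiable_bigsum.
apply: differentiable_bigprod => k; case: (a k); first exact: dc.
by apply: differentiableB; [exact: differentiable_cst|exact: dc].
Qed.

Lemma shape_multiaffine a : multiaffine (shape_fun (R:=R) a).
Proof.
case: s a => /= a x k t.
  case: unlift => [l|]; first by rewrite !mxE; case: eqP => _; ring.
  have sumU r : \sum_l upd x k r 0 l = r + \sum_(l | l != k) x 0 l.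
    rewrite (bigD1 k)//= mxE eqxx; congr +%R.
    by apply: eq_bigr => l /negbTE lk; rewrite mxE lk.
  by rewrite !sumU; ring.
have prodU r : \prod_l (if a l then upd x k r 0 l else 1 - upd x k r 0 l) =
    (if a k then r else 1 - r) *
    \prod_(l | l != k) (if a l then x 0 l else 1 - x 0 l).
  rewrite (bigD1 k)//= mxE eqxx; congr *%R.
  by apply: eq_bigr => l /negbTE lk; rewrite mxE lk.
by rewrite !prodU; case: (a k); ring.
Qed.

Lemma shape_sum1 x : \sum_(a : ref_vertex d s) shape_fun a x = 1.
Proof.
case: s => /=.
  rewrite big_ord_recl unlift_none.
  under [X in _ + X]eq_bigr do rewrite liftK.
  by rewrite subrK.
rewrite -(bigA_distr_bigA (fun k (b : bool) => if b then x 0 k else 1 - x 0 k)).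
by apply: big1 => k _; rewrite big_bool /=; ring.
Qed.

Lemma shape_ge0 a x : ref_cell R d s x -> 0 <= shape_fun a x.
Proof.
case: s a => /= a.
  by move=> [x0 x1]; case: unlift => [k|]; rewrite ?subr_ge0.
by move=> x01; apply: prodr_ge0 => k _; have /andP[] := x01 k; case: (a k) => //;
  rewrite subr_ge0.
Qed.

Lemma shape_ref_point a b : shape_fun a (ref_point R b) = (a == b)%:R.
Proof.
case: s a b => /= a b.
  case: (unliftP ord0 a) => [k ->|->]; case: (unliftP ord0 b) => [l ->|->] /=.
  - by rewrite mxE eqxx (inj_eq lift_inj).
  - by rewrite mxE.
  - rewrite (bigD1 l)//= mxE !eqxx big1 ?addr0 ?subrr// => m /negbTE ml.
    by rewrite mxE ml andbF.
  - by rewrite big1 ?subr0// => m _; rewrite mxE.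
have [->|nab] := eqVneq a b.
  by rewrite big1// => k _; rewrite mxE; case: (b k) => //; rewrite subr0.
have [k abk] : exists k, a k != b k.
  apply/existsP; rewrite -negb_forall; apply: contra nab => /forallP h.
  by apply/eqP/ffunP => k; exact/eqP/h.
rewrite (bigD1 k)//= mxE; case: (a k) (b k) abk => -[]//= _.
  by rewrite mul0r.
by rewrite subrr mul0r.
Qed.

Lemma ref_point_in a : ref_cell R d s (ref_point R a).
Proof.
case: s a => /= a; last by move=> k; rewrite mxE; case: (a k); rewrite lexx ler01.
case: unlift => [k|].
  split=> [l|]; first by rewrite mxE; case: (_ && _).
  rewrite (bigD1 k)//= mxE !eqxx big1 ?addr0// => l /negbTE lk.
  by rewrite mxE lk andbF.
by split=> [l|]; [rewrite mxE|rewrite big1 ?ler01// => l _; rewrite mxE].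
Qed.

Lemma ref_cell_unit x : ref_cell R d s x -> forall k, 0 <= x 0 k <= 1.
Proof.
case: s => //= -[x0 x1] k; rewrite x0/= (le_trans _ x1)//.
by rewrite (bigD1 k)//= lerDl sumr_ge0.
Qed.

Lemma ref_cell_compact : compact (ref_cell R d s).
Proof.
apply: bounded_closed_compact.
  exists 1; split=> // M M1 x xr; apply/row_norm_le; first lra.
  by move=> k; have /andP[x0 x1] := ref_cell_unit xr k; rewrite ger0_norm//; lra.
have closed_ge (g : 'rV[R]_d -> R) : continuous g -> closed [set x | 0 <= g x].
  move=> cg; apply: (@closed_comp _ _ g [set y | 0 <= y]) => [y _|].
    exact: cg.
  exact: closed_ge.
have all_closed (P : 'I_d -> set 'rV[R]_d) : (forall k, closed (P k)) ->
    closed [set x | forall k, P k x].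
  move=> cP; rewrite [X in closed X](_ : _ = \bigcap_k P k).
    by apply: closed_bigI => k _; exact: cP.
  by apply/seteqP; split=> x h k //=; exact: h.
case: s => /=.
  rewrite [X in closed X](_ : _ = [set x : 'rV[R]_d | forall k, 0 <= x 0 k] `&`
     [set x : 'rV[R]_d | 0 <= 1 - \sum_k x 0 k]); last first.
    by apply/seteqP; split=> x [? h]; split=> //=; move: h => /=; rewrite subr_ge0.
  apply: closedI.
    by apply: all_closed => k; apply: closed_ge; exact: coord_continuous.
  apply: closed_ge; apply: continuous_subr; first exact: cst_continuous.
  by apply: continuous_sumr => k; exact: coord_continuous.
rewrite [X in closed X](_ : _ = [set x : 'rV[R]_d | forall k, 0 <= x 0 k] `&`
   [set x : 'rV[R]_d | forall k, 0 <= 1 - x 0 k]); last first.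
  apply/seteqP; split=> x.
    by move=> h; split=> k; have /andP[h0 h1] := h k => //=; rewrite subr_ge0.
  by move=> [h0 h1] k; have /= := h1 k; rewrite subr_ge0 h0 => ->.
apply: closedI; apply: all_closed => k; apply: closed_ge.
  exact: coord_continuous.
by apply: continuous_subr; [exact: cst_continuous|exact: coord_continuous].
Qed.

Definition ref_int : set 'rV[R]_d :=
  match s with
  | Simplex => [set x | (forall k, 0 < x 0 k) /\ \sum_k x 0 k < 1]
  | Cube => [set x | forall k, 0 < x 0 k < 1]
  end.

Lemma ref_int_nbhs x : ref_int x -> \forall y \near x, ref_cell R d s y.
Proof.
have near_gt0 (g : 'rV[R]_d -> R) : continuous g -> 0 < g x ->
    \forall y \near x, 0 < g y.
  by move=> cg gx; exact: (cg x _ (lt_nbhsr gx)).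
have c1 k : continuous (fun y : 'rV[R]_d => 1 - y 0 k).
  by apply: continuous_subr; [exact: cst_continuous|exact: coord_continuous].
have c2 : continuous (fun y : 'rV[R]_d => 1 - \sum_k y 0 k).
  apply: continuous_subr; first exact: cst_continuous.
  by apply: continuous_sumr => k; exact: coord_continuous.
rewrite /ref_int; case: s => /=.
  move=> [x0 x1].
  have h1 : \forall y \near x, forall k, 0 < (y : 'rV[R]_d) 0 k.
    apply: (@near_forall _ _ (fun k => [set y : 'rV[R]_d | 0 < y 0 k])) => k.
    by apply: (near_gt0 (fun y => y 0 k)) => //;
      exact: coord_continuous.
  have h2 : \forall y \near x, 0 < 1 - \sum_k (y : 'rV[R]_d) 0 k.
    by apply: (near_gt0 (fun y => 1 - \sum_k y 0 k)) => //; rewrite subr_gt0.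
  by apply: filterS2 h1 h2 => y y0 y1; split=> [k|]; [rewrite ltW|lra].
move=> x01.
apply: (@near_forall _ _ (fun k => [set y : 'rV[R]_d | 0 <= y 0 k <= 1])) => k.
have /andP[x0 x1] := x01 k.
have h1 : \forall y \near x, 0 < (y : 'rV[R]_d) 0 k.
  by apply: (near_gt0 (fun y => y 0 k)) => //; exact: coord_continuous.
have h2 : \forall y \near x, 0 < 1 - (y : 'rV[R]_d) 0 k.
  by apply: (near_gt0 (fun y => 1 - y 0 k)) => //; rewrite subr_gt0.
by apply: filterS2 h1 h2 => y y0 y1; apply/andP; split; lra.
Qed.

(** A face that meets the interior is the whole cell: every point of the cell is
the end of a segment of the cell through the given interior point. *)
Lemma proper_face_int F z : is_face (ref_cell R d s) F -> F <> ref_cell R d s ->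
  F z -> ~ ref_int z.
Proof.
move=> [subF _ extF] nF Fz zint; apply: nF; apply/seteqP; split=> // x xP.
have cl : (fun t : R => z + t *: (z - x)) @ (0 : R) --> z + 0 *: (z - x).
  apply: cvgD; first exact: cvg_cst.
  by apply: cvgZr_tmp; exact: cvg_id.
rewrite scale0r addr0 in cl.
have /cl/nbhs_ballP[e /= e0 he] := ref_int_nbhs zint.
(* t is small enough for the segment to continue past z inside the cell, and l is
   the position of z on the segment from x to z + t (z - x). *)
pose t := e / 2.
have t0 : 0 < t by rewrite divr_gt0.
have : ref_cell R d s (z + t *: (z - x)).
  by apply: he; rewrite /ball/= sub0r normrN gtr0_norm// /t; lra.
move=> yP; pose l := t / (1 + t).
have t1 : 1 + t != 0 by lra.
have l01 : 0 < l < 1.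
  have t1p : 0 < 1 + t by lra.
  by rewrite /l divr_gt0// ltr_pdivrMr//; lra.
have [] // := extF x (z + t *: (z - x)) l xP yP l01.
rewrite [X in F X](_ : _ = z)//.
apply/rowP => k; rewrite !mxE /l; field.
exact: t1.
Qed.

End Reference.

(** * The geometric map of an element *)

Section LipschitzMultiaffine.
Variables (R : realType) (d : nat).

Definition unit_cube : set 'rV[R]_d := ref_cell R d Cube.

Lemma unit_cube_mix x y n : unit_cube x -> unit_cube y -> unit_cube (mix x y n).
Proof. by move=> xc yc k; rewrite mxE; case: ifP. Qed.

Lemma multiaffine_lipschitz (f : 'rV[R]_d -> R) :
  multiaffine f -> continuous f ->
  exists2 L, 0 <= L & forall x y, unit_cube x -> unit_cube y ->
    `|f x - f y| <= L * `|x - y|.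
Proof.
move=> mf cf.
have bnd k : exists B, forall x, unit_cube x -> `|slope f k x| <= B.
  have /compact_bounded[B [Breal hB]] : compact (slope f k @` unit_cube).
    apply: continuous_compact; last exact: ref_cell_compact.
    by apply: continuous_subspaceT; exact: slope_continuous.
  by exists (B + 1) => x xc; apply: hB; [lra|exists x].
have [B hB] := choice bnd.
exists (\sum_k `|B k|) => [|x y xc yc]; first exact: sumr_ge0.
rewrite multiaffine_increment// mulr_suml (le_trans (ler_norm_sum _ _ _))//.
apply: ler_sum => k _; rewrite normrM mulrC ler_pM//.
  by rewrite (le_trans (hB k _ _)) ?ler_norm//; exact: unit_cube_mix.
by have := coord_norm_le (x - y) k; rewrite !mxE.
Qed.

End LipschitzMultiaffine.

Section Cell.
Variables (R : realType) (d : nat) (T : mesh R d).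
Implicit Types (K : elt T) (x y w : 'rV[R]_d) (l k : 'I_d).

Local Notation V3 := ('rV[R]_d * 'rV[R]_d * 'rV[R]_d)%type.

Definition geoc K l x : R := geo K x 0 l.

Lemma geocE K l x :
  geoc K l x = \sum_(a : ref_vertex d (shp K)) pos (vtx a) 0 l * shape_fun a x.
Proof.
rewrite /geoc /geo summxE; apply: eq_bigr => a _.
by rewrite mxE mulrC.
Qed.

Lemma geoc_multiaffine K l : multiaffine (geoc K l).
Proof.
move=> x k s; rewrite !geocE.
exact: (multiaffine_sum (fun a => pos (vtx a) 0 l)
  (@shape_multiaffine R d (shp K))).
Qed.

Lemma shape_comb_continuous K (c : ref_vertex d (shp K) -> R) :
  continuous (fun x => \sum_a c a * shape_fun a x).
Proof.
apply: continuous_sumr => a; apply: continuous_mulr; first exact: cst_continuous.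
exact: shape_continuous.
Qed.

Lemma geoc_continuous K l : continuous (geoc K l).
Proof. by rewrite (funext (geocE K l)); exact: shape_comb_continuous. Qed.

Lemma geo_continuous K : continuous (geo K).
Proof. by apply: continuous_row => l; exact: geoc_continuous. Qed.

Lemma geo_ref_point K (a : ref_vertex d (shp K)) :
  geo K (ref_point R a) = pos (vtx a).
Proof.
rewrite /geo (bigD1 a)//= shape_ref_point eqxx scale1r big1 ?addr0// => b ba.
by rewrite shape_ref_point (negbTE ba) scale0r.
Qed.

Lemma vertex_in_cell K i : is_vertex K i -> cell K (pos i).
Proof.
by case=> a <-; exists (ref_point R a); [exact: ref_point_in|exact: geo_ref_point].
Qed.

Lemma cell_compact K : compact (cell K).
Proof.
apply: continuous_compact; last exact: ref_cell_compact.
by apply: continuous_subspaceT; exact: geo_continuous.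
Qed.

Lemma cell_closed K : closed (cell K).
Proof. by apply: compact_closed; [exact: norm_hausdorff|exact: cell_compact]. Qed.

Lemma geo_lipschitz K : exists2 L, 0 <= L & forall x y,
  unit_cube x -> unit_cube y -> `|geo K x - geo K y| <= L * `|x - y|.
Proof.
have [L hL] := choice (fun l =>
  let: ex_intro2 L L0 hL := multiaffine_lipschitz (@geoc_multiaffine K l)
     (@geoc_continuous K l) in ex_intro _ L (conj L0 hL)).
exists (\sum_l L l) => [|x y xc yc]; first by apply: sumr_ge0 => l _; case: (hL l).
apply/row_norm_le => [|l].
  by apply: mulr_ge0 => //; apply: sumr_ge0 => l _; case: (hL l).
rewrite !mxE; have [_ h] := hL l; apply: (le_trans (h x y xc yc)).
rewrite ler_wpM2r// (bigD1 l)//= lerDl; apply: sumr_ge0 => m _.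
by case: (hL m).
Qed.

(** The chord matrix turns the increment of the geometric map into an exact
linear expression; on the diagonal it is the Jacobian matrix. *)
Definition chord K x y w : 'rV[R]_d :=
  \row_l \sum_k w 0 k * slope (geoc K l) k (mix x y k).

Lemma geo_increment K x y : geo K x - geo K y = chord K x y (x - y).
Proof.
apply/rowP => l; rewrite !mxE -/(geoc K l x) -/(geoc K l y).
rewrite multiaffine_increment; last exact: geoc_multiaffine.
by apply: eq_bigr => k _; rewrite !mxE.
Qed.

Lemma chordZ K x y (s : R) w : chord K x y (s *: w) = s *: chord K x y w.
Proof.
apply/rowP => l; rewrite !mxE mulr_sumr.
by apply: eq_bigr => k _; rewrite mxE mulrA.
Qed.

Lemma chord_continuous K :
  continuous (fun p : V3 => chord K p.1.1 p.1.2 p.2).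
Proof.
apply: continuous_row => l.
rewrite [X in continuous X](_ : _ = fun p : V3 =>
  \sum_k p.2 0 k * slope (geoc K l) k (mix p.1.1 p.1.2 k)); last first.
  by apply/funext => p; rewrite mxE.
apply: continuous_sumr => k; apply: continuous_mulr.
  apply: (@continuous_compfun _ _ _ snd (fun v : 'rV[R]_d => v 0 k)).
    by move=> p; exact: cvg_snd.
  exact: coord_continuous.
apply: (@continuous_compfun _ _ _
  (fun p : V3 => mix p.1.1 p.1.2 k)).
  apply: (@continuous_compfun _ _ _ fst
    (fun p : 'rV[R]_d * 'rV[R]_d => mix p.1 p.2 k)).
    by move=> p; exact: cvg_fst.
  exact: mix_continuous.
by apply: slope_continuous; exact: geoc_continuous.
Qed.

Lemma geo_differentiable K x : differentiable (geo K) x.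
Proof.
apply: differentiable_bigsum => a; apply: differentiableZl.
exact: shape_differentiable.
Qed.

Lemma chord_jacobian K x w : chord K x x w = w *m 'J (geo K) x.
Proof.
rewrite -deriveEjacobian; last exact: geo_differentiable.
rewrite /derive; apply/esym; apply: (@cvg_lim _ (@norm_hausdorff _ _)).
have cl : (fun h : R => chord K (h *: w + x) x w) @ (0 : R) -->
    chord K (0 *: w + x) x w.
  apply: (@continuous_compfun _ _ _
    (fun h : R => ((h *: w + x, x), w)) (fun p => chord K p.1.1 p.1.2 p.2)).
    apply: continuous_pairing; last exact: cst_continuous.
    apply: continuous_pairing; last exact: cst_continuous.
    exact: line_continuous.
  exact: chord_continuous.
rewrite scale0r add0r in cl.
have cl' : (fun h : R => chord K (h *: w + x) x w) @ (0 : R)^' -->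
    chord K x x w by exact: cvg_within_filter.
apply: cvg_trans cl'; apply: near_eq_cvg; near=> h.
have h0 : h != 0 by near: h; exact: nbhs_dnbhs_neq.
by rewrite /= geo_increment addrK chordZ scalerA mulVf// scale1r.
Unshelve. all: by end_near. Qed.

(** A valid element is expanded at a positive rate by its geometric map: on the
compact set of triples (x, y, w) with w the unit direction of x - y, the chord
matrix applied to w does not vanish, by injectivity off the diagonal and by the
Jacobian on it. *)
Lemma geo_expand K : valid_element K -> exists2 c, 0 < c &
  forall x y, ref_cell R d (shp K) x -> ref_cell R d (shp K) y ->
    c * `|x - y| <= `|geo K x - geo K y|.
Proof.
move=> [_ injK detK].
pose P := [set p : V3 |
  [/\ ref_cell R d (shp K) p.1.1, ref_cell R d (shp K) p.1.2,
      `|p.2| = 1 & p.1.1 - p.1.2 = `|p.1.1 - p.1.2| *: p.2]].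
pose g (p : V3) := `|chord K p.1.1 p.1.2 p.2|.
have cg : continuous g.
  apply: (@continuous_compfun _ _ _
    (fun p => chord K p.1.1 p.1.2 p.2) (fun v : 'rV[R]_d => `|v|)).
    exact: chord_continuous.
  exact: norm_continuous.
have gpos p : P p -> 0 < g p.
  move=> [x1 x2 w1 e]; rewrite /g normr_gt0; apply/eqP => h.
  have [e12|n12] := eqVneq p.1.1 p.1.2.
    move: h; rewrite e12 chord_jacobian => /eqP.
    have U : 'J (geo K) p.1.2 \in unitmx by rewrite unitmxE unitfE detK.
    rewrite -[0](mul0mx _ ('J (geo K) p.1.2)) => /eqP.
    move=> /(can_inj (mulmxK U)) w0.
    by move: w1; rewrite w0 normr0 => /eqP; rewrite eq_sym oner_eq0.
  have : geo K p.1.1 - geo K p.1.2 = 0.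
    by rewrite geo_increment e chordZ h scaler0.
  move=> /eqP; rewrite subr_eq0 => /eqP /injK; rewrite !inE => /(_ x1 x2) e12.
  by move: n12; rewrite e12 eqxx.
have Pcompact : compact P.
  have sphere : compact [set w : 'rV[R]_d | `|w| = 1].
    apply: bounded_closed_compact.
      by exists 1; split=> // M M1 w /= ->; exact: ltW.
    apply: (@closed_comp _ _ (fun v : 'rV[R]_d => `|v|) [set 1]) => [w _|].
      exact: norm_continuous.
    exact: closed_eq.
  apply: (@subclosed_compact _ P
    ((ref_cell R d (shp K) `*` ref_cell R d (shp K)) `*`
     [set w : 'rV[R]_d | `|w| = 1])).
  - have c1 : continuous (fun p : V3 => p.1).
      by move=> p; exact: cvg_fst.
    have cw : continuous (fun p : V3 => p.2).
      by move=> p; exact: cvg_snd.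
    have cx : continuous (fun p : V3 => p.1.1).
      apply: (@continuous_compfun _ _ _ _ fst c1).
      by move=> p; exact: cvg_fst.
    have cy : continuous (fun p : V3 => p.1.2).
      apply: (@continuous_compfun _ _ _ _ snd c1).
      by move=> p; exact: cvg_snd.
    have ref_closed : closed (ref_cell R d (shp K)).
      apply: compact_closed; last exact: ref_cell_compact.
      exact: norm_hausdorff.
    have cxy : continuous (fun p : V3 =>
        `|p.1.1 - p.1.2|).
      apply: (@continuous_compfun _ _ _
        (fun p : V3 => p.1.1 - p.1.2)
        (fun v => `|v|)); last exact: norm_continuous.
      by move=> p; apply: cvgB; [exact: cx|exact: cy].
    have cn : continuous (fun p : V3 =>
        `|p.1.1 - p.1.2 - `|p.1.1 - p.1.2| *: p.2|).
      apply: (@continuous_compfun _ _ _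
        (fun p : V3 =>
           p.1.1 - p.1.2 - `|p.1.1 - p.1.2| *: p.2)
        (fun v => `|v|)); last exact: norm_continuous.
      move=> p; apply: cvgB; first by apply: cvgB; [exact: cx|exact: cy].
      by apply: cvgZ; [exact: cxy|exact: cw].
    rewrite (_ : P =
        (fun p : V3 => p.1.1) @^-1`
           ref_cell R d (shp K) `&`
        (fun p : V3 => p.1.2) @^-1`
           ref_cell R d (shp K) `&`
        (fun p : V3 => p.2) @^-1`
           [set w | `|w| = 1] `&`
        (fun p : V3 =>
          `|p.1.1 - p.1.2 - `|p.1.1 - p.1.2| *: p.2|) @^-1` [set 0]).
      apply: closedI; [apply: closedI; [apply: closedI|]|].
      + by apply: closed_comp => // p _; exact: cx.
      + by apply: closed_comp => // p _; exact: cy.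
      + apply: closed_comp => [p _|]; first exact: cw.
        by apply: compact_closed => //; exact: norm_hausdorff.
      + by apply: closed_comp => [p _|]; [exact: cn|exact: closed_eq].
    apply/seteqP; split=> [p [? ? ? e]|p [[[? ?] ?] /= e]].
      by split=> //=; rewrite -e subrr normr0.
    by split=> //; apply/eqP; rewrite -subr_eq0 -normr_eq0 e.
  - by apply: compact_setX => //; apply: compact_setX; exact: ref_cell_compact.
  - by move=> p [].
have dir x y : ref_cell R d (shp K) x -> ref_cell R d (shp K) y -> x != y ->
    P ((x, y), `|x - y|^-1 *: (x - y)).
  move=> xr yr xy; split=> //=.
    by rewrite normrZ normfV normr_id mulVf// normr_eq0 subr_eq0.
  by rewrite scalerA mulfV ?scale1r// normr_eq0 subr_eq0.
have [P0|/set0P/negP/negPn/eqP P0] := pselect (P !=set0).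
  have [p /set_mem Pp hp] := compact_EVT_min P0 Pcompact
    (continuous_subspaceT cg).
  exists (g p) => [|x y xr yr]; first exact: gpos.
  have [->|xy] := eqVneq x y; first by rewrite !subrr !normr0 mulr0.
  have := hp _ (mem_set (dir x y xr yr xy)); rewrite /g/= => h.
  rewrite geo_increment mulrC.
  have -> : chord K x y (x - y) =
      `|x - y| *: chord K x y (`|x - y|^-1 *: (x - y)).
    by rewrite -chordZ scalerA mulfV ?scale1r// normr_eq0 subr_eq0.
  by rewrite normrZ normr_id ler_wpM2l.
exists 1 => // x y xr yr; have [->|xy] := eqVneq x y.
  by rewrite !subrr !normr0 mulr0.
by have := dir x y xr yr xy; rewrite P0.
Qed.

End Cell.

(** * Differentiability of the finite element functions inside a cell *)

Section CellFunction.
Variables (R : realType) (d : nat) (T : mesh R d).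
Implicit Types (K : elt T) (x y w : 'rV[R]_d) (l k : 'I_d).

Lemma ref_unit_cube s x : ref_cell R d s x -> unit_cube x.
Proof. exact: ref_cell_unit. Qed.

(** The geometric map expands distances, so its inverse is Lipschitz. *)
Lemma cell_lipschitz K (v S : 'rV[R]_d -> R) : valid_element K ->
  multiaffine S -> continuous S ->
  (forall y, ref_cell R d (shp K) y -> v (geo K y) = S y) ->
  exists2 L, 0 <= L & forall x y, cell K x -> cell K y ->
    `|v x - v y| <= L * `|x - y|.
Proof.
move=> vK mS cS vS; have [c c0 hc] := geo_expand vK.
have [L L0 hL] := multiaffine_lipschitz mS cS.
exists (L / c) => [|_ _ [x xr <-] [y yr <-]]; first by rewrite divr_ge0// ltW.
rewrite !vS// (le_trans (hL _ _ (ref_unit_cube xr) (ref_unit_cube yr)))//.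
by rewrite -mulrA ler_wpM2l// mulrC ler_pdivlMr// mulrC hc.
Qed.

(** The gradient g of v solves J g = (slopes of S at xh), with J the Jacobian matrix.
Subtracting from S the function y |-> geo y . g makes all the slopes at xh vanish; what
remains is o(|y - xh|), hence o(h) because the preimage of x + h w stays within O(h)
of xh. *)
Lemma cell_derivable K (v S : 'rV[R]_d -> R) x w : valid_element K ->
  multiaffine S -> continuous S ->
  (forall y, ref_cell R d (shp K) y -> v (geo K y) = S y) ->
  nbhs x (cell K) -> derivable v x w.
Proof.
move=> vK mS cS vS Kx; have [c c0 hc] := geo_expand vK.
have [xh xhr exh] := nbhs_singleton Kx.
pose J := 'J (geo K) xh.
have JU : J \in unitmx by rewrite unitmxE unitfE; case: vK => _ _; apply.
pose g : 'cV[R]_d := invmx J *m \col_k slope S k xh.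
have Jkl k l : slope (geoc K l) k xh = J k l.
  have /rowP/(_ l) := chord_jacobian K xh (delta_mx 0 k).
  rewrite -rowE !mxE => <-; rewrite (bigD1 k)//= mxE !eqxx mul1r mix_same.
  by rewrite big1 ?addr0// => m /negbTE mk; rewrite mxE mk andbF mul0r.
(* S with its differential at xh removed. *)
pose f y := S y - \sum_l g l 0 * geoc K l y.
have mf : multiaffine f.
  have mg := multiaffine_sum (fun l => g l 0) (@geoc_multiaffine R d T K).
  by move=> z k s; rewrite /f mS [\sum_l _]mg; ring.
have cf : continuous f.
  apply: continuous_subr => //; apply: continuous_sumr => l.
  by apply: continuous_mulr; [exact: cst_continuous|exact: geoc_continuous].
have slope0 k : slope f k xh = 0.
  have : \sum_l J k l * g l 0 = slope S k xh.
    have : J *m g = \col_k slope S k xh by rewrite mulKVmx.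
    by move=> /colP/(_ k); rewrite !mxE.
  under eq_bigr do rewrite -Jkl /slope mulrC mulrBr.
  by rewrite sumrB /slope /f => e; lra.
pose G y := \sum_k `|slope f k (mix y xh k)|.
have cG : continuous G.
  apply: continuous_sumr => k.
  apply: (@continuous_compfun _ _ _ _ (fun r : R => `|r|));
    last exact: norm_continuous.
  apply: continuous_compfun; last exact: slope_continuous.
  apply: (@continuous_compfun _ _ _ (fun y => (y, xh)) (fun p => mix p.1 p.2 k));
    last exact: mix_continuous.
  by apply: continuous_pairing => [y|]; [exact: cvg_id|exact: cst_continuous].
have G0 : G xh = 0.
  by rewrite /G big1// => k _; rewrite mix_same slope0 normr0.
apply/cvg_ex; exists (\sum_l w 0 l * g l 0); apply/cvgrPdist_lt => e e0.
pose e' := e * c / (`|w| + 1).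
have w1 : 0 < `|w| + 1 by rewrite ltr_wpDl.
have e'0 : 0 < e' by rewrite !mulr_gt0// invr_gt0.
have /nbhs_ballP[r /= r0 hr] : \forall y \near xh, G y < e'.
  have /cvgrPdist_lt/(_ _ e'0) := cG xh.
  apply: filterS => y; rewrite G0 sub0r normrN ger0_norm//.
  exact: sumr_ge0.
have inK : \forall h \near (0 : R)^', cell K (h *: w + x).
  exact: line_dnbhs.
have small : \forall h \near (0 : R)^', `|h| < r * c / (`|w| + 1).
  by apply: dnbhs0_lt; rewrite !mulr_gt0// invr_gt0.
near=> h.
have h0 : h != 0 by near: h; exact: nbhs_dnbhs_neq.
have [yh yhr eyh] : cell K (h *: w + x) by near: h.
have hs : `|h| < r * c / (`|w| + 1) by near: h.
have dist : `|yh - xh| <= `|h| * `|w| / c.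
  rewrite ler_pdivlMr// mulrC (le_trans (hc _ _ yhr xhr))// eyh exh addrK.
  by rewrite normrZ.
have -> : \sum_l w 0 l * g l 0 - h^-1 *: ((v \o shift x) (h *: w) - v x) =
    - (h^-1 * (f yh - f xh)).
  have hg : \sum_l g l 0 * geoc K l yh - \sum_l g l 0 * geoc K l xh =
      h * \sum_l w 0 l * g l 0.
    rewrite -sumrB mulr_sumr; apply: eq_bigr => l _.
    by rewrite -mulrBr /geoc eyh exh !mxE; ring.
  rewrite /= /shift/= -eyh vS// -exh vS// /f.
  rewrite -[LHS]/(_ - h^-1 * _).
  have -> : \sum_l w 0 l * g l 0 = h^-1 * (\sum_l g l 0 * geoc K l yh -
      \sum_l g l 0 * geoc K l xh) by rewrite hg mulKf.
  ring.
rewrite normrN normrM normfV mulrC ltr_pdivrMr ?normr_gt0//.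
have yhG : G yh < e'.
  apply: hr; rewrite -ball_normE /ball_/= distrC (le_lt_trans dist)//.
  rewrite ltr_pdivrMr//; move: hs; rewrite ltr_pdivlMr// => hs.
  by apply: le_lt_trans hs; rewrite ler_wpM2l// lerDl.
have : `|f yh - f xh| <= `|yh - xh| * G yh.
  rewrite multiaffine_increment// mulr_sumr (le_trans (ler_norm_sum _ _ _))//.
  apply: ler_sum => k _; rewrite normrM ler_wpM2r//.
  by have := coord_norm_le (yh - xh) k; rewrite !mxE.
move=> /le_lt_trans; apply.
apply: (@le_lt_trans _ _ (`|h| * `|w| / c * e')).
  apply: ler_pM => //; last exact: ltW.
  by apply: sumr_ge0.
rewrite /e' [X in X < _](_ : _ = (e * `|h|) * (`|w| / (`|w| + 1))); last first.
  by field; rewrite !gt_eqF.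
rewrite gtr_pMr; last by rewrite mulr_gt0// normr_gt0.
by rewrite ltr_pdivrMr// mul1r ltrDl.
Unshelve. all: by end_near. Qed.

Lemma derive_lipschitz (v : 'rV[R]_d -> R) x w L : derivable v x w ->
  (\forall y \near x, `|v y - v x| <= L * `|y - x|) -> `|'D_w v x| <= L * `|w|.
Proof.
move=> dv hL.
have cl : (fun h : R => `|h^-1 *: ((v \o shift x) (h *: w) - v x)|) @ (0 : R)^'
   --> `|'D_w v x| by apply: cvg_norm.
apply: (cvgr_to_le cl); near=> h.
have h0 : h != 0 by near: h; exact: nbhs_dnbhs_neq.
have : `|v (h *: w + x) - v x| <= L * `|h *: w + x - x|.
  near: h.
  exact: (@line_dnbhs R d w x [set y | `|v y - v x| <= L * `|y - x|]).
rewrite addrK normrZ => hv; rewrite /= /shift/= normrZ normfV.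
by rewrite mulrC ler_pdivrMr ?normr_gt0// -mulrA [_ * `|h|]mulrC.
Unshelve. all: by end_near. Qed.

End CellFunction.

(** * The skeleton of the mesh has content zero *)

Section BoundaryPieces.
Variables (R : realType) (d : nat).
Implicit Types (x y : 'rV[R]_d) (k l : 'I_d).

(** On the simplex, b selects the oblique face instead of the face orthogonal to
the k-th axis; k is then the coordinate that the others determine. *)
Definition bd_piece (s : cell_shape) k (b : bool) : set 'rV[R]_d :=
  [set x | unit_cube x /\
    match s with
    | Simplex => if b then \sum_l x 0 l = 1 else x 0 k = 0
    | Cube => x 0 k = b%:R
    end].

Lemma bd_piece_cover s x : (0 < d)%N -> ref_cell R d s x -> ~ ref_int s x ->
  exists k b, bd_piece s k b x.
Proof.
move=> d0 xr nx; have xc := ref_unit_cube xr; apply: contrapT => np.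
have {}np k b : ~ bd_piece s k b x by move=> h; apply: np; exists k, b.
apply: nx; rewrite /ref_int; case: s xr np => xr np.
  have [x0 x1] := xr; split=> [k|].
    rewrite lt_neqAle x0 andbT eq_sym; apply/eqP => e.
    by apply: (np k false); split.
  rewrite lt_neqAle x1 andbT; apply/eqP => e.
  by apply: (np (Ordinal d0) true); split.
move=> k; have /andP[x0 x1] := xr k; rewrite !lt_neqAle x0 x1 !andbT.
apply/andP; split; apply/eqP => e.
  by apply: (np k false); split.
by apply: (np k true); split.
Qed.

(** On each piece of the boundary one coordinate is a Lipschitz function of the
others: the piece is a hypersurface. *)
Lemma bd_piece_graph s k b x y e : bd_piece s k b x -> bd_piece s k b y ->
  0 <= e -> (forall l, l != k -> `|x 0 l - y 0 l| <= e) -> `|x - y| <= d%:R * e.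
Proof.
move=> [_ hx] [_ hy] e0 he.
have d1 : 1 <= d%:R :> R by rewrite ler1n (leq_ltn_trans (leq0n k)).
have led : e <= d%:R * e by rewrite ler_peMl.
apply/row_norm_le => [|l]; first by rewrite mulr_ge0.
rewrite !mxE; have [->|lk] := eqVneq l k; last exact: le_trans (he l lk) led.
case: s hx hy => /=; last by move=> -> ->; rewrite subrr normr0 mulr_ge0.
case: b => [|-> ->]; last by rewrite subrr normr0 mulr_ge0.
rewrite (bigD1 k)//= [X in _ -> X = _ -> _](bigD1 k)//= => hx hy.
have -> : x 0 k - y 0 k = - \sum_(m | m != k) (x 0 m - y 0 m).
  by rewrite sumrB; lra.
rewrite normrN (le_trans (ler_norm_sum _ _ _))//.
apply: (@le_trans _ _ (\sum_(m | m != k) e)); first exact: ler_sum.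
apply: (@le_trans _ _ (\sum_(m < d) e)).
  by rewrite [X in _ <= X](bigD1 k)//= lerDr.
by rewrite sumr_const card_ord mulr_natl.
Qed.

End BoundaryPieces.

Section ContentZero.
Variables (R : realType) (d : nat).
Implicit Types (Z : set 'rV[R]_d).

(** In the sup norm the balls are cubes, of volume (2 r)^d. *)
Definition content0 Z : Prop := forall e : R, 0 < e ->
  exists s : seq ('rV[R]_d * R),
    [/\ forall p, p \in s -> 0 <= p.2,
        forall x, Z x -> exists2 p, p \in s & `|x - p.1| <= p.2 &
        \sum_(p <- s) (2 * p.2) ^+ d <= e].

Lemma content0_sub Z Z' : Z `<=` Z' -> content0 Z' -> content0 Z.
Proof.
by move=> sub h e /h[s [s1 s2 s3]]; exists s; split=> // x /sub; exact: s2.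
Qed.

Lemma content0_bigcup (I : finType) (Z : I -> set 'rV[R]_d) :
  (forall i, content0 (Z i)) -> content0 (\bigcup_i Z i).
Proof.
move=> hZ; suff h (r : seq I) : content0 [set x | exists2 i, i \in r & Z i x].
  apply: content0_sub (h (enum I)) => x [i _ Zx].
  by exists i => //; rewrite mem_enum.
elim: r => [|i r IH] e e0.
  by exists [::]; split=> //= [x []//|]; rewrite big_nil ltW.
have e2 : 0 < e / 2 by rewrite divr_gt0.
have [s1 [p1 c1 m1]] := hZ i _ e2; have [s2 [p2 c2 m2]] := IH _ e2.
exists (s1 ++ s2); split.
- by move=> p; rewrite mem_cat => /orP[/p1|/p2].
- move=> x [j]; rewrite inE => /orP[/eqP ->|jr] Zx.
    by have [p ps hp] := c1 x Zx; exists p; rewrite // mem_cat ps.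
  by have [|p ps hp] := c2 x; [exists j|exists p; rewrite // mem_cat ps orbT].
- by rewrite big_cat/=; lra.
Qed.

End ContentZero.

Section ContentPiece.
Variable R : realType.

Lemma grid_point (t : R) n : 0 <= t <= 1 ->
  exists i : 'I_n.+1, i%:R / n.+1%:R <= t <= i.+1%:R / n.+1%:R.
Proof.
move=> /andP[t0 t1].
have n0 : (0 : R) < n.+1%:R by rewrite ltr0n.
have ex : exists i : nat, (i <= n)%N && (t <= i.+1%:R / n.+1%:R).
  by exists n; rewrite leqnn divff// gt_eqF.
case: (ex_minnP ex) => i /andP[lein ti] mini.
exists (Ordinal (lein : (i < n.+1)%N)) => /=; rewrite ti andbT.
case: i lein ti mini => [|i] lein ti mini; first by rewrite mul0r.
rewrite leNgt; apply/negP => lt; have := mini i.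
by rewrite (ltnW lein) ltW//= => /(_ isT); rewrite ltnn.
Qed.

(** A piece of the boundary is covered by n^(d-1) cubes of side 1/n, which a
Lipschitz map sends into cubes of side O(1/n): the total volume is O(1/n). *)
Lemma content0_bd_piece d s (k : 'I_d) b (g : 'rV[R]_d -> 'rV[R]_d) L :
  0 <= L ->
  (forall x y, unit_cube x -> unit_cube y -> `|g x - g y| <= L * `|x - y|) ->
  content0 (g @` bd_piece s k b).
Proof.
case: d k g => [[]//|d] k g L0 hg e e0.
pose C := (2 * (L * d.+1%:R)) ^+ d.+1.
have C0 : 0 <= C by rewrite exprn_ge0// !mulr_ge0.
have [n hn] : exists n : nat, C / n.+1%:R <= e.
  exists (Num.truncn (C / e)); rewrite ler_pdivrMr ?ltr0n// mulrC -ler_pdivrMr//.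
  by rewrite ltW// truncnS_gt.
have n0 : (0 : R) < n.+1%:R by rewrite ltr0n.
pose near_idx (j : {ffun 'I_d -> 'I_n.+1}) (x : 'rV[R]_d.+1) :=
  forall l, (j l)%:R / n.+1%:R <= x 0 (lift k l) <= (j l).+1%:R / n.+1%:R.
(* A point of the piece over the j-th cell of the grid, if there is one. *)
pose c j := get [set y | bd_piece s k b y /\ near_idx j y].
pose r := L * (d.+1%:R * n.+1%:R^-1).
have r0 : 0 <= r by rewrite !mulr_ge0// invr_ge0 ltW.
exists [seq (g (c j), r) | j <- enum {ffun 'I_d -> 'I_n.+1}]; split.
- by move=> p /mapP[j _ ->].
- move=> _ [x xB <-].
  have [j hj] := choice (fun l => grid_point n (xB.1 (lift k l))).
  pose J : {ffun 'I_d -> 'I_n.+1} := [ffun l => j l].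
  have xJ : near_idx J x by move=> l; rewrite ffunE.
  exists (g (c J), r); first by apply: map_f; rewrite mem_enum.
  have [cB cJ] : [set y | bd_piece s k b y /\ near_idx J y] (c J).
    by apply: getPex; exists x.
  rewrite /= (le_trans (hg _ _ xB.1 cB.1))// ler_wpM2l//.
  apply: (bd_piece_graph xB cB); first by rewrite invr_ge0 ltW.
  move=> l; case: (unliftP k l) => [m ->|->]; last by rewrite eqxx.
  move=> _; have /andP[x1 x2] := xJ m; have /andP[c1 c2] := cJ m.
  have eS : (J m).+1%:R / n.+1%:R = (J m)%:R / n.+1%:R + n.+1%:R^-1 :> R.
    by rewrite -natr1 mulrDl mul1r.
  rewrite eS in x2 c2; move: x1 x2 c1 c2; move: (_ / _) => a.
  move: (n.+1%:R^-1) (c J) => u y' x1 x2 c1 c2.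
  by rewrite ler_norml; apply/andP; split; lra.
- rewrite big_map big_enum/= sumr_const card_ffun !card_ord.
  suff -> : (2 * r) ^+ d.+1 *+ (n.+1 ^ d) = C / n.+1%:R by [].
  have -> : 2 * r = 2 * (L * d.+1%:R) * n.+1%:R^-1 by rewrite /r; ring.
  rewrite -mulr_natr natrX exprMn -/C [n.+1%:R^-1 ^+ d.+1]exprS exprVn -!mulrA.
  by rewrite mulVf ?mulr1// expf_neq0// gt_eqF.
Qed.

End ContentPiece.

Section CellBoundary.
Variables (R : realType) (d : nat) (T : mesh R d) (Omega : set 'rV[R]_d).

Definition cell_interiors : set 'rV[R]_d :=
  [set x | exists K : elt T, nbhs x (cell K)].

Lemma cell_interiors_open : open cell_interiors.
Proof.
rewrite (_ : cell_interiors = \bigcup_K (cell (T := T) K)^°).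
  by apply: bigcup_open => K _; exact: open_interior.
by apply/seteqP; split=> x; [move=> [K Kx]; exists K|move=> [K _ Kx]; exists K].
Qed.

(** By conformity the image of an interior point of a reference cell lies in no other
element. The other elements form a closed set, so near this point the open domain
is covered by the one element that contains it. What remains of the domain comes from
the boundaries of the reference cells. *)
Lemma content0_skeleton : (0 < d)%N -> open Omega -> conforming_mesh T Omega ->
  content0 (Omega `\` cell_interiors).
Proof.
move=> d0 oO [_ vK mK cover].
pose piece (p : elt T * ('I_d * bool)) :=
  geo p.1 @` @bd_piece R _ (shp p.1) p.2.1 p.2.2.
apply: (@content0_sub _ _ _ (\bigcup_p piece p)); last first.
  apply: content0_bigcup => -[K [k b]].
  have [L L0 hL] := geo_lipschitz K.
  exact: content0_bd_piece L0 hL.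
move=> x [Ox nx].
have [K _ [xh xhr exh]] : (\bigcup_K cell (T := T) K) x.
  by rewrite cover; exact: subset_closure.
have [xhi|xhn] := pselect (ref_int (shp K) xh); last first.
  have [k [b hb]] := bd_piece_cover d0 xhr xhn.
  by exists (K, (k, b)) => //; exists xh.
have other K' : K' <> K -> ~ cell K' x.
  move=> nK xK'; have [F [F' [[fF fF'] [nF nF'] e1 e2 _]]] := mK _ _ (nesym nK).
  have : (cell K `&` cell K') x by split=> //; exists xh.
  rewrite e1 => -[z Fz ez].
  have zr : ref_cell R d (shp K) z by case: fF => sub _ _; exact: sub.
  have ezx : z = xh.
    by case: (vK K) => _ inj _; apply: inj; rewrite ?inE// ez exh.
  by apply: (proper_face_int fF nF Fz); rewrite ezx.
exfalso; apply: nx; exists K.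
have : \forall y \near x, forall K', K' <> K -> ~ cell K' y.
  apply: (@near_forall _ _ (fun K' => [set y | K' <> K -> ~ cell K' y])) => K'.
  have [->|nK] := pselect (K' = K).
    by apply: nbhs_all => y /(_ erefl).
  have : nbhs x (~` cell K').
    by apply: open_nbhs_nbhs; split; [exact/closed_openC/cell_closed|exact: other].
  by apply: filterS => y ny _.
have Onear : nbhs x Omega by exact: open_nbhs_nbhs.
apply: filterS2 Onear => y Oy ny.
have [K' _ yK'] : (\bigcup_K cell (T := T) K) y.
  by rewrite cover; exact: subset_closure.
by have [<-//|/ny] := pselect (K' = K).
Qed.

End CellBoundary.

(** * Lebesgue measure on tuples *)

Section LebesgueTuple.
Variables (R : realType).
Notation M := (measurableTypeR R).

Definition tuple_row d (t : d.-tuple M) : 'rV[R]_d := \row_k tnth t k.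

Definition tuple_box d (a b : 'I_d -> R) : set (d.-tuple M) :=
  [set t | forall k, a k <= tnth t k <= b k].

Lemma tuple_box_measurable d (a b : 'I_d -> R) : measurable (tuple_box a b).
Proof.
rewrite (_ : tuple_box a b =
    \bigcap_k (fun t : d.-tuple M => tnth t k) @^-1` `[a k, b k]%classic).
  apply: fin_bigcap_measurable => // k _.
  by rewrite -[X in measurable X]setTI; apply: (@measurable_tnth _ M).
apply/seteqP; split=> t h k; first by move=> _ /=; rewrite in_itv/=; exact: h.
by have := h k I; rewrite /= in_itv.
Qed.

Lemma lebesgue_tuple_box d (a b : 'I_d -> R) : (forall k, a k <= b k) ->
  lebesgue_tuple R d (tuple_box a b) = (\prod_k (b k - a k))%:E.
Proof.
elim: d a b => [|d IH] a b ab.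
  by rewrite big_ord0 /= diracE mem_set// => -[].
rewrite /= /lebesgue_step /pushforward.
rewrite (_ : _ @^-1` _ = `[a ord0, b ord0]%classic `*`
    tuple_box (a \o lift ord0) (b \o lift ord0)); last first.
  apply/seteqP; split=> -[x t] /=.
    move=> h; split.
      by have := h ord0; rewrite (tnth_nth x)/= in_itv.
    by move=> k; have := h (lift ord0 k); rewrite tnthS.
  rewrite in_itv/= => -[h0 h] k; case: (unliftP ord0 k) => [l ->|->].
    by rewrite tnthS; exact: h.
  by rewrite (tnth_nth x).
rewrite product_measure1E; [|exact: measurable_itv|exact: tuple_box_measurable].
rewrite big_ord_recl EFinM; congr (_ * _)%E; last by apply: IH => k; exact: ab.
have : @lebesgue_measure R `[a ord0, b ord0]%classic = (b ord0 - a ord0)%:E.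
  rewrite lebesgue_measure_itv/= lte_fin.
  have := ab ord0; rewrite le_eqVlt => /orP[/eqP e|->]; last by rewrite EFinB.
  by rewrite e ltxx subrr.
exact.
Qed.

Lemma row_ball_box d (c : 'rV[R]_d) r : 0 <= r ->
  @tuple_row d @^-1` [set x | `|x - c| <= r] =
  tuple_box (fun k => c 0 k - r) (fun k => c 0 k + r).
Proof.
move=> r0; apply/seteqP; split=> t /=.
  move=> /(row_norm_le _ r0) h k; have := h k; rewrite !mxE ler_norml => /andP[].
  by move=> h1 h2; apply/andP; split; lra.
move=> h; apply/(row_norm_le _ r0) => k; have /andP[h1 h2] := h k.
by rewrite !mxE ler_norml; apply/andP; split; lra.
Qed.

Lemma row_ball_measurable d (c : 'rV[R]_d) r :
  measurable (@tuple_row d @^-1` [set x | `|x - c| <= r]).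
Proof.
have [r0|r0] := leP 0 r.
  by rewrite row_ball_box//; exact: tuple_box_measurable.
rewrite (_ : _ @^-1` _ = set0)//; apply/seteqP; split=> // t /= h.
by have := le_lt_trans h r0; rewrite normr_lt0.
Qed.

Lemma row_ball_measure d (c : 'rV[R]_d) r : 0 <= r ->
  lebesgue_tuple R d (@tuple_row d @^-1` [set x | `|x - c| <= r]) =
  ((2 * r) ^+ d)%:E.
Proof.
move=> r0; rewrite row_ball_box// lebesgue_tuple_box => [|k]; last by lra.
rewrite (eq_bigr (fun=> 2 * r)) => [|k _]; last by ring.
by rewrite prodr_const card_ord.
Qed.

(** An open set is a countable union of closed balls with rational centres. *)
Lemma row_open_measurable d (U : set 'rV[R]_d) : open U ->
  measurable (@tuple_row d @^-1` U).
Proof.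
move=> oU.
pose B (p : 'rV[rat]_d * nat) : set 'rV[R]_d :=
  [set x | `|x - map_mx ratr p.1| <= p.2.+1%:R^-1].
rewrite (_ : U = \bigcup_p (if `[< B p `<=` U >] then B p else set0)).
  rewrite preimage_bigcup; apply: countable_bigcupT_measurable => [|p].
    exact: countableP.
  by case: ifP => _; [exact: row_ball_measurable|rewrite preimage_set0].
apply/seteqP; split=> x; last first.
  by move=> [p _]; case: ifP => // /asboolP sub; exact: sub.
move=> Ux; have /nbhs_ballP[e /= e0 he] : nbhs x U by exact: open_nbhs_nbhs.
have [n hn] : exists n : nat, n.+1%:R^-1 < e / 2.
  exists (Num.truncn (e / 2)^-1); rewrite invf_plt ?posrE ?divr_gt0//.
  exact: truncnS_gt.
have n0 : (0 : R) < n.+1%:R^-1 by rewrite invr_gt0.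
have hk k : exists c : rat, `|x 0 k - ratr c| <= n.+1%:R^-1.
  move: n.+1%:R^-1 n0 => u u0.
  have [c] : exists c : rat, ratr c \in `](x 0 k - u), (x 0 k + u)[.
    by apply: rat_in_itvoo; lra.
  rewrite in_itv/= => /andP[h1 h2]; exists c.
  by rewrite ler_norml; apply/andP; split; lra.
have [c hc] := choice hk.
have xB : B (\row_k c k, n) x.
  apply/(row_norm_le _ (ltW n0)) => k; rewrite !mxE; exact: hc.
exists (\row_k c k, n) => //; rewrite asboolT// => y yB.
apply: he; rewrite -ball_normE /ball_/=.
have -> : x - y = (x - map_mx ratr (\row_k c k)) - (y - map_mx ratr (\row_k c k)).
  by rewrite opprB addrA subrK.
rewrite (le_lt_trans (ler_normB _ _))//; move: xB yB; rewrite /B/=.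
by move: n.+1%:R^-1 hn => u hu; lra.
Qed.

Lemma row_continuous_measurable d (U : set 'rV[R]_d) (g : 'rV[R]_d -> R) :
  open U -> (forall x, U x -> {for x, continuous g}) ->
  measurable_fun (@tuple_row d @^-1` U) (g \o @tuple_row d : _ -> M).
Proof.
move=> oU cg mD; apply: (measurability _ (RGenOInfty.measurableE R)) => //.
move=> _ [_ [a ->] <-].
apply: (@row_open_measurable d (U `&` g @^-1` `]a, +oo[%classic)).
rewrite openE => x [Ux gx].
apply: filterI; first exact: open_nbhs_nbhs.
have := cg x Ux; apply; rewrite /= in_itv/= andbT in gx.
by move: (lt_nbhsr gx); apply: filterS => y ay; rewrite /= in_itv/= andbT.
Qed.

Lemma content0_null d (Z : set 'rV[R]_d) (A : set (d.-tuple M)) :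
  content0 Z -> measurable A -> A `<=` @tuple_row d @^-1` Z ->
  lebesgue_tuple R d A = 0%E.
Proof.
move=> Z0 mA AZ; apply/eqP; rewrite eq_le measure_ge0 andbT.
apply/lee_addgt0Pr => e e0; rewrite add0e.
have [s [s0 cov tot]] := Z0 e e0.
apply: (@le_trans _ _ (\sum_(p <- s) (2 * p.2) ^+ d)%:E); last by rewrite lee_fin.
have {}cov : A `<=` [set t | exists2 p, p \in s & `|tuple_row t - p.1| <= p.2].
  by move=> t /AZ /cov.
elim: s A s0 mA cov {tot AZ} => [|p s IH] A s0 mA cov.
  rewrite big_nil (_ : A = set0) ?measure0//.
  by apply/seteqP; split=> // t /cov[].
pose B := @tuple_row d @^-1` [set x | `|x - p.1| <= p.2].
have mB : measurable B by exact: row_ball_measurable.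
rewrite -(setUIDK A B) (le_trans (measureU2 _ _ _))//.
- exact: measurableI.
- exact: measurableD.
rewrite big_cons EFinD; apply: leeD.
  rewrite -(row_ball_measure p.1 (s0 p (mem_head _ _))).
  by apply: le_measure; rewrite ?inE//; exact: measurableI.
apply: IH; last first.
- move=> t [/cov[r]]; rewrite inE => /orP[/eqP -> //|rs hr _].
  by exists r.
- exact: measurableD.
- by move=> r rs; apply: s0; rewrite inE rs orbT.
Qed.

End LebesgueTuple.

(** * Integrals of arbitrary functions outside of null sets *)

Section NullSet.
Context {d} {T : measurableType d} {R : realType}.
Variable mu : {measure set T -> \bar R}.
Implicit Types (f : T -> \bar R) (D N : set T).
Import HBNNSimple.
Local Open Scope ereal_scope.

(** The integral of an arbitrary function is a supremum over simple functions, so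
a null set may be discarded whether or not the integrand is measurable. *)
Lemma ge0_null_integral D N f : measurable N -> mu N = 0 ->
  (forall x, D x -> 0 <= f x) ->
  \int[mu]_(x in D) f x = \int[mu]_(x in D `\` N) f x.
Proof.
move=> mN N0 f0; have f0' x : (D `\` N) x -> 0 <= f x by move=> [/f0].
rewrite !ge0_integralE//; apply/eqP; rewrite eq_le; apply/andP; split.
  apply: ge_ereal_sup => _ /= [h hf <-].
  have mNC : measurable (~` N) by exact: measurableC.
  apply: le_ereal_sup_tmp; exists (sintegral mu (proj_nnsfun h mNC)).
    exists (proj_nnsfun h mNC) => // x; rewrite -mrestrict.
    rewrite /patch in_setD; have := hf x; rewrite /patch in_setC.
    by case: (x \in N); case: (x \in D).
  rewrite -mrestrict -(integral_nnsfun mu mNC h) -setTD.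
  rewrite -ge0_negligible_integral//.
  - by rewrite integral_nnsfun// patch_setT.
  - by apply/measurable_EFinP.
  - by move=> x _; rewrite lee_fin.
apply: ereal_sup_le => _ /= [h hf <-]; exists h => // x.
rewrite (le_trans (hf x))// /patch in_setD.
case: ifPn => [/andP[-> _]//|_].
by case: ifPn => // /set_mem /f0.
Qed.

Lemma null_integral D N f : measurable N -> mu N = 0 ->
  \int[mu]_(x in D) f x = \int[mu]_(x in D `\` N) f x.
Proof.
move=> mN N0; rewrite integralE [RHS]integralE.
by rewrite (ge0_null_integral (N := N) mN N0)// [X in _ - X]
  (ge0_null_integral (N := N) mN N0).
Qed.

End NullSet.

Section RintegralSum.
Context {d} {T : measurableType d} {R : realType}.
Variable mu : {measure set T -> \bar R}.

Lemma Rintegral_bigsum (I : Type) (r : seq I) (P : pred I) (f : I -> T -> R)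
    (D : set T) :
  measurable D -> (forall i, P i -> mu.-integrable D (EFin \o f i)) ->
  (\int[mu]_(x in D) (\sum_(i <- r | P i) f i x))%R =
  \sum_(i <- r | P i) (\int[mu]_(x in D) f i x)%R.
Proof.
move=> mD fi.
pose S (s : seq I) x := \sum_(i <- s | P i) f i x.
have Scons i s : S (i :: s) = if P i then (fun x => f i x + S s x) else S s.
  by apply/funext => x; rewrite /S big_cons; case: (P i).
suff [_ //] : mu.-integrable D (EFin \o S r) /\
  (\int[mu]_(x in D) S r x)%R = \sum_(i <- r | P i) (\int[mu]_(x in D) f i x)%R.
elim: r => [|i r [IH1 IH2]].
  have -> : S [::] = cst 0 by apply/funext => x; rewrite /S big_nil.
  rewrite big_nil; split; first exact: integrable0.
  by rewrite /Rintegral integral0.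
rewrite Scons big_cons; case: ifP => // Pi; split; last first.
  by rewrite RintegralD ?IH2//; exact: fi.
rewrite (_ : _ \o _ = (EFin \o f i) \+ (EFin \o S r))%E//.
by apply: integrableD => //; exact: fi.
Qed.

End RintegralSum.

(** * Finite element functions and the nodal basis *)

Section FiniteElements.
Variables (R : realType) (d : nat) (T : mesh R d) (Omega : set 'rV[R]_d).
Hypothesis conf : conforming_mesh T Omega.
Implicit Types (i j : node T) (K : elt T) (x y : 'rV[R]_d) (v : 'rV[R]_d -> R).

Lemma cell_valid K : valid_element K.
Proof. by case: conf. Qed.

Lemma pos_inj : injective (@pos _ _ T).
Proof. by case: conf => -[]. Qed.

Lemma cell_cover x : closure Omega x -> exists K, cell K x.
Proof. by case: conf => _ _ _ <- [K _ Kx]; exists K. Qed.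

Lemma cell_closure K x : cell K x -> closure Omega x.
Proof. by case: conf => _ _ _ <- Kx; exists K. Qed.

Lemma node_cell i : exists K, is_vertex K i.
Proof. by case: conf => -[_]. Qed.

Lemma node_closure i : closure Omega (pos i).
Proof. by have [K /vertex_in_cell/cell_closure] := node_cell i. Qed.

Lemma fe_cellE v K xh : fe_space T Omega v -> ref_cell R d (shp K) xh ->
  v (geo K xh) = \sum_(a : ref_vertex d (shp K)) v (pos (vtx a)) * shape_fun a xh.
Proof.
move=> [_ /(_ K)[c hc]] xr; rewrite hc//; apply: eq_bigr => a _; congr (_ * _).
rewrite -geo_ref_point hc; last exact: ref_point_in.
rewrite (bigD1 a)//= shape_ref_point eqxx mulr1 big1 ?addr0// => b ba.
by rewrite shape_ref_point (negbTE ba) mulr0.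
Qed.

Lemma fe_spaceN v : fe_space T Omega v -> fe_space T Omega (fun x => - v x).
Proof.
move=> [cv hv]; split=> [x|K]; first by apply: cvgN; exact: cv.
have [c hc] := hv K; exists (fun a => - c a) => xh xr.
by rewrite hc// -sumrN; apply: eq_bigr => a _; rewrite mulNr.
Qed.

Lemma fe_le_nodes v b x : fe_space T Omega v -> closure Omega x ->
  (forall j, v (pos j) <= b) -> v x <= b.
Proof.
move=> fv /cell_cover[K [xh xr <-]] hb; rewrite fe_cellE//.
rewrite -[leRHS]mulr1 -(shape_sum1 (shp K) xh) mulr_sumr.
by apply: ler_sum => a _; rewrite ler_wpM2r//; exact: shape_ge0.
Qed.

Lemma fe_continuous v x : open Omega -> fe_space T Omega v -> Omega x ->
  {for x, continuous v}.
Proof.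
move=> oO [cv _] Ox; have cO : closure Omega x by exact: subset_closure.
have Onear : nbhs x (closure Omega).
  apply: (@filterS _ (nbhs x) _ Omega); first exact: subset_closure.
  exact: open_nbhs_nbhs.
rewrite /prop_for /continuous_at.
by rewrite (@nbhs_subspace_interior _ (closure Omega))//; exact: cv.
Qed.

Lemma fe_multiaffine v K : fe_space T Omega v -> exists S : 'rV[R]_d -> R,
  [/\ multiaffine S, continuous S &
      forall y, ref_cell R d (shp K) y -> v (geo K y) = S y].
Proof.
move=> [_ /(_ K)[c hc]]; exists (fun y => \sum_a c a * shape_fun a y); split=> //.
  exact: (multiaffine_sum _ (@shape_multiaffine R d (shp K))).
exact: shape_comb_continuous.
Qed.

Lemma fe_derivable v x w : fe_space T Omega v -> cell_interiors T x ->
  derivable v x w.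
Proof.
move=> fv [K Kx]; have [S [mS cS vS]] := fe_multiaffine K fv.
exact: (cell_derivable (cell_valid K) mS cS vS Kx).
Qed.

Lemma fe_derive_bounded v w : fe_space T Omega v ->
  exists2 L, 0 <= L & forall x, cell_interiors T x -> `|'D_w v x| <= L.
Proof.
move=> fv.
have hK K : exists L, 0 <= L /\ forall x y, cell K x -> cell K y ->
    `|v x - v y| <= L * `|x - y|.
  have [S [mS cS vS]] := fe_multiaffine K fv.
  by have [L L0 hL] := cell_lipschitz (cell_valid K) mS cS vS; exists L.
have [L hL] := choice hK.
have L0 K : 0 <= L K by case: (hL K).
exists (\sum_K L K * `|w|) => [|x [K Kx]].
  by apply: sumr_ge0 => K _; rewrite mulr_ge0.
apply: (@le_trans _ _ (L K * `|w|)); last first.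
  by rewrite (bigD1 K)//= lerDl sumr_ge0// => K' _; rewrite mulr_ge0.
apply: derive_lipschitz; first by apply: fe_derivable => //; exists K.
have xK := nbhs_singleton Kx.
by apply: filterS Kx => y yK; exact: (hL K).2.
Qed.

End FiniteElements.

Section NodalBasis.
Variables (R : realType) (d : nat) (T : mesh R d) (Omega : set 'rV[R]_d).
Hypothesis conf : conforming_mesh T Omega.
Variable phi : node T -> 'rV[R]_d -> R.
Hypothesis basis : nodal_basis Omega phi.
Implicit Types (i j : node T) (K : elt T) (x y : 'rV[R]_d).

Lemma phi_fe j : fe_space T Omega (phi j).
Proof. by case: basis. Qed.

Lemma phi_cellE j K xh : ref_cell R d (shp K) xh ->
  phi j (geo K xh) =
    \sum_(a : ref_vertex d (shp K)) (vtx a == j)%:R * shape_fun a xh.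
Proof.
move=> xr; rewrite (fe_cellE (phi_fe j) xr); apply: eq_bigr => a _.
by case: basis => _ ->.
Qed.

Lemma phi_ge0 j x : closure Omega x -> 0 <= phi j x.
Proof.
move=> /(cell_cover conf)[K [xh xr <-]]; rewrite phi_cellE//.
by apply: sumr_ge0 => a _; rewrite mulr_ge0//; exact: shape_ge0.
Qed.

Lemma phi_le1 j x : closure Omega x -> phi j x <= 1.
Proof.
move=> cx; apply: (fe_le_nodes conf (phi_fe j) cx) => i.
by case: basis => _ ->; rewrite lern1; case: eqP.
Qed.

Lemma pos_nbr i K (a : ref_vertex d (shp K)) : is_vertex K i -> vtx a \in nbr i.
Proof.
move=> iK; rewrite inE; apply/asboolP; exists K => //.
by apply: vertex_in_cell; exists a.
Qed.

Lemma nbr_refl i : i \in nbr i.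
Proof. by have [K [a <-]] := node_cell conf i; apply: pos_nbr; exists a. Qed.

(** Wherever phi_i does not vanish, i is a vertex of the cell, so that all the basis
functions that live on this cell belong to neighbours of i. *)
Lemma phi_sum_nbr i K x y : cell K x -> phi i x != 0 -> cell K y ->
  \sum_(j in nbr i) phi j y = 1.
Proof.
move=> [xh xr <-] nz [yh yr <-].
have iK : is_vertex K i.
  apply: contrapT => ni; move: nz; rewrite phi_cellE// big1 ?eqxx// => a _.
  by have [e|_] := eqVneq (vtx a) i; [case: ni; exists a|rewrite mul0r].
under eq_bigr do rewrite phi_cellE//.
rewrite exchange_big/= -[RHS](shape_sum1 (shp K) yh).
apply: eq_bigr => a _; rewrite -mulr_suml (bigD1 (vtx a))/=; last exact: pos_nbr.
rewrite eqxx big1 ?addr0 ?mul1r// => j /andP[_].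
by rewrite eq_sym => /negbTE ->.
Qed.

End NodalBasis.

(** * Gradients and mass matrix *)

Section FiniteElementIntegrals.
Variables (R : realType) (d : nat) (T : mesh R d) (Omega : set 'rV[R]_d).
Hypotheses (conf : conforming_mesh T Omega) (openO : open Omega)
  (bndO : bounded_set Omega).
Variable phi : node T -> 'rV[R]_d -> R.
Hypothesis basis : nodal_basis Omega phi.
Implicit Types (i j : node T) (K : elt T) (x y : 'rV[R]_d) (v : 'rV[R]_d -> R).
Local Notation M := (measurableTypeR R).
Local Notation mu := (lebesgue_tuple R d).
Local Notation row := (@tuple_row R d).

Lemma bounded_row_measure (U : set 'rV[R]_d) : U `<=` Omega -> open U ->
  (mu (row @^-1` U) < +oo)%E.
Proof.
move=> UO oU; have [B [_ hB]] := bndO.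
pose r := `|B| + 1.
have r0 : 0 <= r by rewrite addr_ge0.
have sub : row @^-1` U `<=` row @^-1` [set x | `|x - 0| <= r].
  move=> t /= /UO Ot; rewrite subr0; apply: hB => //.
  by rewrite /r (le_lt_trans (ler_norm B))// ltrDl.
apply: (@le_lt_trans _ _ (mu (row @^-1` [set x | `|x - 0| <= r]))).
  apply: le_measure => //; rewrite ?inE; first exact: row_open_measurable.
  exact: row_ball_measurable.
by rewrite row_ball_measure// ltry.
Qed.

Lemma fe_measurable v (U : set 'rV[R]_d) : U `<=` Omega -> open U ->
  fe_space T Omega v -> measurable_fun (row @^-1` U) (v \o row).
Proof.
move=> UO oU fv; apply: row_continuous_measurable => // x /UO Ox.
exact: (fe_continuous openO fv Ox).
Qed.

(** The derivative is a limit of difference quotients. Extending v by zero makes them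
measurable everywhere, and the extension disappears in the limit because the domain
is open. *)
Lemma derive_measurable v k : fe_space T Omega v ->
  measurable_fun (row @^-1` (Omega `&` cell_interiors T))
    (fun t => 'D_(delta_mx 0 k) v (row t)).
Proof.
move=> fv; set e : 'rV[R]_d := delta_mx 0 k.
pose P := v \_ Omega.
have mP c : measurable_fun setT (fun t => P (c + row t)).
  pose D := [set x | Omega (c + x)].
  have oD : open D.
    apply: (@open_comp _ _ (fun x => c + x)) => // x _.
    exact: shift_continuous.
  rewrite (_ : (fun t => P (c + row t)) =
      ((fun t => v (c + row t)) \_ (row @^-1` D))); last first.
    apply/funext => t; rewrite /P /patch.
    by congr (if _ then _ else _); apply/idP/idP => /set_mem h; exact/mem_set.
  have mD : measurable (row @^-1` D) by exact: row_open_measurable.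
  apply/(measurable_restrictT _ mD).
  apply: (@row_continuous_measurable _ _ D (fun x => v (c + x))) => // x Dx.
  apply: (@continuous_comp _ _ _ (fun x => c + x)).
    exact: shift_continuous.
  exact: (fe_continuous openO fv Dx).
pose h n (t : d.-tuple M) : R :=
  (@harmonic R n)^-1 * (P (@harmonic R n *: e + row t) - P (0 + row t)).
apply: (@measurable_fun_cvg _ _ _ _ h) => [n|t [Ot It]].
  apply: measurable_funM; first exact: measurable_cst.
  by apply: measurable_funB; apply: measurable_funTS; exact: mP.
have dv := fe_derivable conf (w := e) fv It.
have harm0 : @harmonic R @ \oo --> (0 : R)^'.
  move=> A hA; change (\forall n \near \oo, A (@harmonic R n)).
  have : \forall n \near \oo, harmonic n != 0 :> R -> A (harmonic n).
    exact: (@cvg_harmonic R _ hA).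
  apply: filterS => n; apply.
  by have := @harmonic_gt0 R n; rewrite lt0r => /andP[].
have cl : (fun n => (@harmonic R n)^-1 *:
    ((v \o shift (row t)) (@harmonic R n *: e) - v (row t))) @ \oo -->
    'D_e v (row t).
  apply: (@cvg_comp _ _ _ (@harmonic R) (fun s : R => s^-1 *:
    ((v \o shift (row t)) (s *: e) - v (row t))) _ _ _ harm0); exact: dv.
apply: cvg_trans cl; apply: near_eq_cvg; near=> n.
rewrite /h /= add0r /P /patch [row t \in _]mem_set// mem_set//.
near: n; apply: (harm0 [set s | Omega (s *: e + row t)]).
by apply: line_dnbhs; exact: open_nbhs_nbhs.
Unshelve. all: by end_near. Qed.

Lemma mass_ge0 i j : 0 <= mass Omega phi i j.
Proof.
apply: Rintegral_ge0 => t Ot.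
by apply: mulr_ge0; apply: (phi_ge0 conf basis); exact: subset_closure.
Qed.

(** By continuity phi_i is at least 1/2 on a ball of positive measure; the ball is found
inside the open domain because the node i is adherent to it. *)
Lemma mass_diag_gt0 i : 0 < mass Omega phi i i.
Proof.
have [c [r [r0 sub]]] : exists c r, 0 < r /\ forall x, `|x - c| <= r ->
    Omega x /\ 1 / 2 <= phi i x.
  have cO : closure Omega (pos i) by exact: node_closure.
  have near_i : \forall y \near pos i, closure Omega y -> 1 / 2 <= phi i y.
    have [[cphi _] one] := (phi_fe basis i, basis.2 i i).
    have : phi i @ within (closure Omega) (nbhs (pos i)) --> phi i (pos i).
      by rewrite (nbhs_subspace_in cO); exact: cphi.
    rewrite one eqxx => /(_ [set r | 1 / 2 <= r]); apply.
    have h1 : 1 / 2 < 1 :> R by lra.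
    by apply: filterS (lt_nbhsr h1) => r /ltW.
  have [y [Oy]] := cO _ (nbhs_interior near_i).
  rewrite /interior/= => hy.
  have : nbhs y (Omega `&` [set y | closure Omega y -> 1 / 2 <= phi i y]).
    by apply: filterI => //; exact: open_nbhs_nbhs.
  move=> /nbhs_ballP[e /= e0 he]; exists y, (e / 2).
  split=> [|x xy]; first by rewrite divr_gt0.
  have [Ox hx] : (Omega `&` [set y | closure Omega y -> 1 / 2 <= phi i y]) x.
    apply: he; rewrite -ball_normE /ball_/= distrC (le_lt_trans xy)//.
    by rewrite ltr_pdivrMr// ltr_pMr//; lra.
  by split=> //; apply: hx; exact: subset_closure.
pose B := row @^-1` [set x | `|x - c| <= r].
have BO : B `<=` row @^-1` Omega by move=> t /sub[].
have mB : measurable B by exact: row_ball_measurable.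
have mO : measurable (row @^-1` Omega) by exact: row_open_measurable.
pose g (t : d.-tuple M) := phi i (row t) * phi i (row t).
have mg : measurable_fun (row @^-1` Omega) g.
  by apply: measurable_funM; apply: fe_measurable => //; exact: (phi_fe basis).
have g01 t : (row @^-1` Omega) t -> 0 <= g t <= 1.
  move=> Ot; have cO : closure Omega (row t) by exact: subset_closure.
  have p0 := phi_ge0 conf basis i cO; have p1 := phi_le1 conf basis i cO.
  by rewrite mulr_ge0//= mulr_ile1.
have fin : (\int[mu]_(t in row @^-1` Omega) (g t)%:E < +oo)%E.
  apply: (@le_lt_trans _ _ (\int[mu]_(t in row @^-1` Omega) (1 : R)%:E)%E).
    apply: ge0_le_integral => //.
    - by move=> t /g01 /andP[]; rewrite lee_fin.
    - exact/measurable_EFinP.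
    - by move=> t /g01 /andP[_]; rewrite lee_fin.
  by rewrite integral_cst// mul1e; exact: bounded_row_measure.
rewrite /mass /integral_Rd /Rintegral; apply: fine_gt0; rewrite fin andbT.
apply: (@lt_le_trans _ _ (\int[mu]_(t in B) (1 / 4 : R)%:E)%E).
  have -> : (\int[mu]_(t in B) (1 / 4 : R)%:E = (1 / 4)%:E * ((2 * r) ^+ d)%:E)%E.
    rewrite integral_cst//; congr (_ * _)%E.
    exact: (row_ball_measure c (ltW r0)).
  by rewrite -EFinM lte_fin mulr_gt0// exprn_gt0// mulr_gt0.
apply: (@le_trans _ _ (\int[mu]_(t in B) (g t)%:E)%E).
  apply: ge0_le_integral => //.
  - by apply/measurable_EFinP; exact: measurable_funS mg.
  - move=> t /sub[_ h]; rewrite lee_fin /g.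
    by rewrite (le_trans _ (ler_pM _ _ h h))//; lra.
apply: ge0_subset_integral => //; first exact/measurable_EFinP.
by move=> t /g01 /andP[]; rewrite lee_fin.
Qed.

End FiniteElementIntegrals.

(** * The rows of the transport matrix sum to zero *)

Section TransportRowSum.
Variables (R : realType) (d : nat) (T : mesh R d) (Omega : set 'rV[R]_d).
Hypotheses (d0 : (0 < d)%N) (conf : conforming_mesh T Omega)
  (openO : open Omega) (bndO : bounded_set Omega).
Variable phi : node T -> 'rV[R]_d -> R.
Hypothesis basis : nodal_basis Omega phi.
Variable df : R -> 'rV[R]_d.
Hypotheses (df_meas : forall k, measurable_fun [set: R] (fun s => df s 0 k))
  (df_bnd : exists C, forall s, `|df s| <= C).
Implicit Types (i j : node T) (K : elt T) (x y : 'rV[R]_d) (v : 'rV[R]_d -> R).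
Local Notation mu := (lebesgue_tuple R d).
Local Notation row := (@tuple_row R d).
Local Notation U := (Omega `&` cell_interiors T).

Definition transport_density v i j x : R :=
  (\sum_k df (v x) 0 k * grad (phi j) x 0 k) * phi i x.

Lemma open_smooth_part : open U.
Proof. by apply: openI => //; exact: cell_interiors_open. Qed.

(** The gradients may fail to exist, or to be measurable, on the skeleton of the mesh;
this set is null and does not contribute. *)
Lemma transport_smooth_part v i j : transport Omega phi df v i j =
  (\int[mu]_(t in row @^-1` U) transport_density v i j (row t))%R.
Proof.
rewrite /transport /integral_Rd /Rintegral; congr fine.
have mN : measurable (row @^-1` (Omega `\` cell_interiors T)).
  have -> : row @^-1` (Omega `\` cell_interiors T) =
    row @^-1` Omega `\` row @^-1` cell_interiors T by [].
  by apply: measurableD; apply: row_open_measurable => //;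
    exact: cell_interiors_open.
rewrite (null_integral (mu := mu) _ _ mN).
  congr (integral _ _ _).
  exact: (setDD (row @^-1` Omega) (row @^-1` cell_interiors T)).
by apply: (content0_null (content0_skeleton d0 openO conf) mN).
Qed.

Lemma transport_density_integrable v i j : fe_space T Omega v ->
  mu.-integrable (row @^-1` U) (EFin \o (transport_density v i j \o row)).
Proof.
move=> fv; have oU := open_smooth_part; have UO : U `<=` Omega by move=> x [].
have fj := phi_fe basis j.
apply: measurable_bounded_integrable.
- exact: row_open_measurable.
- exact: (bounded_row_measure bndO UO oU).
- apply: (@measurable_funM _ _ _ _ (fun t =>
      \sum_k df (v (row t)) 0 k * grad (phi j) (row t) 0 k) (phi i \o row));
    last by apply: (fe_measurable openO UO oU); exact: (phi_fe basis).
  apply: measurable_sum => k; apply: measurable_funM.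
    apply: (measurableT_comp (df_meas k)).
    exact: (fe_measurable openO UO oU fv).
  under eq_fun do rewrite mxE.
  exact: (derive_measurable conf openO k fj).
- have [C hC] := df_bnd.
  have [L hL] := choice (fun k =>
    let: ex_intro2 L L0 hL := fe_derive_bounded conf (delta_mx 0 k) fj in
    ex_intro _ L (conj L0 hL)).
  exists (\sum_k C * L k); split; first exact: num_real.
  move=> B hB t [Ot It] /=; rewrite (le_trans _ (ltW hB))//.
  have cO : closure Omega (row t) by exact: subset_closure.
  rewrite /transport_density normrM (ger0_norm (phi_ge0 conf basis i cO)).
  apply: (@le_trans _ _ `|\sum_k df (v (row t)) 0 k * grad (phi j) (row t) 0 k|).
    by rewrite ler_piMr//; exact: (phi_le1 conf basis).
  rewrite (le_trans (ler_norm_sum _ _ _))//; apply: ler_sum => k _.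
  rewrite normrM ler_pM//; last by rewrite mxE; exact: (hL k).2.
  exact: le_trans (coord_norm_le _ k) (hC _).
Qed.

(** In a cell where phi_i is not identically zero the neighbours of i form a
partition of unity, so their gradients cancel. *)
Lemma transport_density_sum0 v i x : U x ->
  \sum_(j in nbr i) transport_density v i j x = 0.
Proof.
move=> [Ox [K Kx]]; rewrite -mulr_suml.
have [->|nz] := eqVneq (phi i x) 0; first by rewrite mulr0.
rewrite exchange_big/= big1 ?mul0r// => k _; rewrite -mulr_sumr.
set e : 'rV[R]_d := delta_mx 0 k.
have dphi j : derivable (phi j) x e.
  by apply: (fe_derivable conf (phi_fe basis j)); exists K.
suff -> : \sum_(j in nbr i) grad (phi j) x 0 k = 0 by rewrite mulr0.
under eq_bigr do rewrite mxE -/e.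
have sumD (r : seq (node T)) : is_derive x e
    (fun y => \sum_(j <- r | j \in nbr i) phi j y)
    (\sum_(j <- r | j \in nbr i) 'D_e (phi j) x).
  elim: r => [|j r IH].
    by rewrite big_nil; under eq_fun do rewrite big_nil; exact: is_derive_cst.
  rewrite big_cons; under eq_fun do rewrite big_cons.
  case: ifP => // _; apply: is_deriveD; exact: derivableP.
have [_ <-] := sumD (index_enum (node T)).
rewrite (@near_eq_derive _ _ R _ (cst (1 : R))); first exact: derive_cst.
have xK := nbhs_singleton Kx.
by apply: filterS Kx => y yK; exact: (phi_sum_nbr basis xK nz yK).
Qed.

Lemma transport_sum0 v i : fe_space T Omega v ->
  \sum_(j in nbr i) transport Omega phi df v i j = 0.
Proof.
move=> fv; under eq_bigr do rewrite transport_smooth_part.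
rewrite -Rintegral_bigsum.
- rewrite (@eq_Rintegral _ _ _ _ _ (fun=> 0)).
    by rewrite /Rintegral integral0.
  by move=> t /set_mem Ut; exact: transport_density_sum0.
- by apply: row_open_measurable; exact: open_smooth_part.
- by move=> j _; exact: transport_density_integrable.
Qed.

End TransportRowSum.

(** * The shock detector at a maximum *)

Section ShockDetector.
Variables (R : realType) (d : nat) (T : mesh R d) (Omega : set 'rV[R]_d).
Hypothesis conf : conforming_mesh T Omega.
Implicit Types (i j : node T) (x y : 'rV[R]_d) (v : 'rV[R]_d -> R).

Lemma enorm_ge0 x : 0 <= enorm x.
Proof. exact: sqrtr_ge0. Qed.

Lemma enorm_gt0 x : x != 0 -> 0 < enorm x.
Proof.
move=> x0; rewrite sqrtr_gt0 lt0r sumr_ge0 ?andbT; last by move=> *; exact: sqr_ge0.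
apply: contra x0 => /eqP s0; apply/eqP/rowP => k; rewrite mxE.
have /eqP := s0; rewrite psumr_eq0 => [|l _]; last exact: sqr_ge0.
by move=> /allP/(_ k (mem_index_enum _)); rewrite /= sqrf_eq0 => /eqP.
Qed.

Lemma patch_closure i x : Defs.patch i x -> closure Omega x.
Proof. by move=> [K _ xK]; apply: (cell_closure conf xK). Qed.

(** The parameters s for which pos i - s r lies in the closed domain form a closed
set, which therefore contains the supremum. *)
Lemma sym_point_closure i j : closure Omega (sym_point i j).
Proof.
rewrite /sym_point /=; set r := pos j - pos i; set S := [set s : R | _].
have inS s : S s -> closure Omega (pos i - s *: r).
  by move=> [s0 /(_ s)]; rewrite s0 lexx => /(_ isT) /patch_closure.
(* Without a supremum, sup is 0 by convention and the point is the node itself. *)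
have [[S0 Sub]|/sup_out ->] := pselect (has_sup S); last first.
  by rewrite scale0r subr0; exact: node_closure.
have cS : closed [set s : R | closure Omega (pos i - s *: r)].
  apply: (@closed_comp _ _ (fun s : R => pos i - s *: r)) => [s _|].
    apply: cvgB; first exact: cvg_cst.
    by apply: cvgZr_tmp; exact: cvg_id.
  exact: closed_closure.
have := closure_sup S0 Sub.
by move=> /(closure_subset (B := [set s : R | closure Omega (pos i - s *: r)]) inS);
  move: cS => /closure_id <-.
Qed.

Lemma Avg_ge0 v i j : 0 <= Avg v i j.
Proof.
by rewrite mulr_ge0// addr_ge0// divr_ge0//; exact: enorm_ge0.
Qed.

(** At a maximum all the jumps have the same sign, so the detector equals 1 unless
the function is constant on the neighbours. *)
Lemma alpha_at_max q v i : fe_space T Omega v ->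
  (forall j, v (pos j) <= v (pos i)) ->
  alpha q v i = 1 \/ forall j, j \in nbr i -> v (pos j) = v (pos i).
Proof.
move=> fv vmax.
have vle x : closure Omega x -> v x <= v (pos i).
  by move=> cx; exact: (fe_le_nodes conf fv cx).
have JA j : Jump v i j = - (2 * Avg v i j).
  rewrite /Jump /Avg mulrA mulfV// mul1r opprD -!mulNr.
  have := vle _ (@sym_point_closure i j); rewrite -subr_le0 => h.
  have := vmax j; rewrite -subr_le0 => h'.
  by rewrite !ler0_norm// !opprK.
rewrite /alpha; case: ifPn => [A0|/negPn/eqP A0].
  left; under eq_bigr do rewrite JA.
  rewrite sumrN normrN -mulr_sumr normrM !ger0_norm//; last first.
    by apply: sumr_ge0 => j _; exact: Avg_ge0.
  by rewrite divff ?powR1// mulf_neq0.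
right=> j jN; have [->//|ji] := eqVneq j i.
move: A0 => /eqP; rewrite psumr_eq0 => [|k _]; last exact: Avg_ge0.
move=> /allP/(_ j (mem_index_enum _)); rewrite jN ji/= mulf_eq0 invr_eq0.
rewrite pnatr_eq0/= paddr_eq0; [|by rewrite divr_ge0// enorm_ge0..].
move=> /andP[+ _]; rewrite mulf_eq0 invr_eq0 normr_eq0 subr_eq0.
case/orP => [/eqP//|/eqP e0].
have : pos j - pos i != 0.
  by rewrite subr_eq0; apply: contra ji => /eqP/(pos_inj conf) ->.
by move=> /enorm_gt0; rewrite e0 ltxx.
Qed.

End ShockDetector.

(** * The discrete maximum principle *)

(** The rows of the transport matrix and of the graph Laplacian sum to zero, so both
act on differences v i - v j only; the remaining mass terms compare v i with the
previous values w. *)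
Lemma graph_laplacian_identity (R : realType) (I : finType) (A : {set I}) (i : I)
    (F m L v w : I -> R) (dt : R) : i \in A -> \sum_(j in A) F j = 0 ->
  \sum_(j in A) m j * ((v j - w j) / dt) +
  \sum_(j in A) (F j + (if i == j then \sum_(k in A | k != i) L k else L j) *
    (2 * (i == j)%:R - 1)) * v j =
  \sum_(j in A) m j * (v i - w j) / dt +
  \sum_(j in A | j != i) (L j - F j - m j / dt) * (v i - v j).
Proof.
move=> iA F0.
have diag (c : I -> R) : \sum_(j in A | j != i) c j * (v i - v j) =
    \sum_(j in A) c j * (v i - v j).
  by rewrite [RHS](bigD1 i)//= subrr mulr0 add0r.
have -> : \sum_(j in A) m j * ((v j - w j) / dt) =
   \sum_(j in A) m j * (v i - w j) / dt -
   \sum_(j in A | j != i) m j / dt * (v i - v j).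
  by rewrite (diag (fun j => m j / dt)) -sumrB; apply: eq_bigr => j _; ring.
have eF : \sum_(j in A) F j * v j = - \sum_(j in A | j != i) F j * (v i - v j).
  rewrite diag; under [in RHS]eq_bigr do rewrite mulrBr.
  by rewrite sumrB -mulr_suml F0 mul0r sub0r opprK.
have eL : \sum_(j in A) (if i == j then \sum_(k in A | k != i) L k else L j) *
    (2 * (i == j)%:R - 1) * v j = \sum_(j in A | j != i) L j * (v i - v j).
  rewrite (bigD1 i)//= eqxx mulr_suml mulr_suml -big_split/=.
  by apply: eq_bigr => j /andP[_ ji]; rewrite [i == j]eq_sym (negbTE ji)/=; ring.
under [X in _ + X]eq_bigr do rewrite mulrDl.
rewrite big_split/= eF eL -addrA; congr +%R.
by rewrite -!sumrN -!big_split/=; apply: eq_bigr => j _; ring.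
Qed.

Section MaximumPrinciple.
Variables (R : realType) (d : nat) (T : mesh R d) (Omega : set 'rV[R]_d).
Hypotheses (d0 : (0 < d)%N) (conf : conforming_mesh T Omega)
  (openO : open Omega) (bndO : bounded_set Omega).
Variable phi : node T -> 'rV[R]_d -> R.
Hypothesis basis : nodal_basis Omega phi.
Variables (q : R) (df : R -> 'rV[R]_d).
Hypotheses (df_meas : forall k, measurable_fun [set: R] (fun s => df s 0 k))
  (df_bnd : exists C, forall s, `|df s| <= C).
Implicit Types (i j : node T) (x y : 'rV[R]_d) (v : 'rV[R]_d -> R).

(** Where the detector is 1 the artificial diffusion dominates the transport and mass
coefficients; where it is 0 the neighbouring values coincide. *)
Lemma nut_off_at_max dt v i j : 0 < dt -> fe_space T Omega v ->
  (forall k : node T, v (pos k) <= v (pos i)) -> j \in nbr i ->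
  0 <= (nut_off Omega phi df q dt v i j - transport Omega phi df v i j -
        mass Omega phi i j / dt) * (v (pos i) - v (pos j)).
Proof.
move=> dt0 fv vmax jN; have [a1|vconst] := alpha_at_max conf q fv vmax; last first.
  by rewrite vconst// subrr mulr0.
apply: mulr_ge0; last by rewrite subr_ge0.
rewrite /nut_off /nu a1 !mul1r.
set F := transport _ _ _ _ _ _; set m := mass _ _ _ _.
set X := Num.max _ 0; set Y := Num.max _ (alpha _ _ _ * mass _ _ _ _).
have XF : F <= X by rewrite /X !le_max lexx.
have Ym : m <= Y by rewrite /Y !le_max lexx.
have : m / dt <= dt^-1 * Y by rewrite mulrC ler_wpM2l// invr_ge0 ltW.
by lra.
Qed.

Lemma residual_identity dt v0 v1 i : fe_space T Omega v1 ->
  scheme_residual Omega phi df q dt v0 v1 i =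
  \sum_(j in nbr i) mass Omega phi i j * (v1 (pos i) - v0 (pos j)) / dt +
  \sum_(j in nbr i | j != i)
    (nut_off Omega phi df q dt v1 i j - transport Omega phi df v1 i j -
     mass Omega phi i j / dt) * (v1 (pos i) - v1 (pos j)).
Proof.
move=> fv.
have F0 := transport_sum0 d0 conf openO bndO basis df_meas df_bnd i fv.
exact: (graph_laplacian_identity (fun j => mass Omega phi i j)
  (fun j => nut_off Omega phi df q dt v1 i j) (fun j => v1 (pos j))
  (fun j => v0 (pos j)) dt (nbr_refl conf i) F0).
Qed.

(** If v1 (pos i) exceeded b, all terms of the identity above would be nonnegative and
the diagonal mass term positive, so the residual could not vanish. *)
Lemma step_max dt v0 v1 b i : 0 < dt -> fe_space T Omega v1 ->
  scheme_residual Omega phi df q dt v0 v1 i = 0 ->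
  (forall j, v1 (pos j) <= v1 (pos i)) -> (forall j, v0 (pos j) <= b) ->
  v1 (pos i) <= b.
Proof.
move=> dt0 fv res vmax v0b; rewrite leNgt; apply/negP => lt.
move: res; rewrite residual_identity// => /eqP; apply/negP; rewrite gt_eqF//.
apply: ltr_wpDr.
  by apply: sumr_ge0 => j /andP[jN _]; exact: nut_off_at_max.
rewrite (bigD1 i)/=; last exact: (nbr_refl conf).
apply: ltr_wpDr.
  apply: sumr_ge0 => j _; rewrite divr_ge0//; last exact: ltW.
  apply: mulr_ge0; first exact: (mass_ge0 conf basis).
  by rewrite subr_ge0 (le_trans (v0b j))// ltW.
rewrite divr_gt0// mulr_gt0//; first exact: (mass_diag_gt0 conf openO bndO basis).
by rewrite subr_gt0 (le_lt_trans (v0b i)).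
Qed.

(** The nodes may lie on the boundary of the domain, where the initial values are
limits of values inside. *)
Lemma fe_closure_le v b x : fe_space T Omega v -> (forall y, Omega y -> v y <= b) ->
  closure Omega x -> v x <= b.
Proof.
move=> [cv _] hb cx; rewrite leNgt; apply/negP => lt.
have near_x : \forall y \near x, closure Omega y -> b < v y.
  have : v @ within (closure Omega) (nbhs x) --> v x.
    by rewrite (nbhs_subspace_in cx); exact: cv.
  by move=> /(_ [set r | b < r]); apply; exact: lt_nbhsr.
have [y [Oy hy]] := cx _ near_x.
have := hy (subset_closure Oy); rewrite ltNge => /negP; apply.
exact: hb.
Qed.

(** A finite element function is largest at a node. At each time step the node of the
maximum either carries an inflow value or satisfies the scheme, in which case the
maximum does not exceed that of the previous step. *)
Lemma global_max (N : nat) (t : nat -> R) (Gin : set ('rV[R]_d * R))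
  (u : nat -> 'rV[R]_d -> R) (b : R) :
  (forall n, (n < N)%N -> t n < t n.+1) ->
  (forall n, (n <= N)%N -> fe_space T Omega (u n)) ->
  (forall n i, (n < N)%N -> ~ Gin (pos i, t n.+1) ->
     scheme_residual Omega phi df q (t n.+1 - t n) (u n) (u n.+1) i = 0) ->
  (forall y, Omega y -> u 0%N y <= b) ->
  (forall n y, (1 <= n <= N)%N -> Gin (y, t n) -> u n y <= b) ->
  forall n x, (n <= N)%N -> Omega x -> u n x <= b.
Proof.
move=> t_incr u_fe u_scheme init inflow.
suff nodes n i : (n <= N)%N -> u n (pos i) <= b.
  move=> n x nN Ox; apply: (fe_le_nodes conf (u_fe n nN) (subset_closure Ox)).
  by move=> i; exact: nodes.
elim: n i => [|n IH] i nN.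
  by apply: (fe_closure_le (u_fe 0%N nN) init); exact: (node_closure conf).
have [i0 _ i0max] := @arg_maxP _ _ _ i xpredT (fun j => u n.+1 (pos j)) isT.
apply: (le_trans (i0max i isT)).
have [inf|notinf] := pselect (Gin (pos i0, t n.+1)).
  by apply: inflow inf; rewrite nN.
apply: (step_max (dt := t n.+1 - t n) (v0 := u n)).
- by rewrite subr_gt0; exact: t_incr.
- exact: u_fe.
- exact: u_scheme.
- by move=> j; exact: i0max.
- by move=> j; apply: IH; exact: ltnW.
Qed.

End MaximumPrinciple.

Section Symmetry.
Variables (R : realType) (d : nat) (T : mesh R d) (Omega : set 'rV[R]_d).
Variables (phi : node T -> 'rV[R]_d -> R) (df : R -> 'rV[R]_d) (q : R).
Implicit Types (i j : node T) (v : 'rV[R]_d -> R).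
Local Notation opp v := (fun x => - v x).
Local Notation dfN := (fun s => df (- s)).

Lemma alphaN v i : alpha q (opp v) i = alpha q v i.
Proof.
have AN j : Avg (opp v) i j = Avg v i j.
  by rewrite /Avg -!opprD !normrN.
have JN j : Jump (opp v) i j = - Jump v i j.
  by rewrite /Jump -!opprD !mulNr opprD.
rewrite /alpha; under eq_bigr do rewrite AN.
under [X in `|X|]eq_bigr do rewrite JN.
under [X in _ / X]eq_bigr do rewrite AN.
by rewrite sumrN normrN.
Qed.

Lemma transportN v i j :
  transport Omega phi dfN (opp v) i j = transport Omega phi df v i j.
Proof.
rewrite /transport; congr integral_Rd; apply/funext => x.
by congr (_ * _); apply: eq_bigr => k _; rewrite opprK.
Qed.

(** Changing the sign of the solution and of the argument of the flux derivative
turns a solution of the scheme into another one. *)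
Lemma residualN dt v0 v1 i :
  scheme_residual Omega phi dfN q dt (opp v0) (opp v1) i =
  - scheme_residual Omega phi df q dt v0 v1 i.
Proof.
have off j k : nut_off Omega phi dfN q dt (opp v1) j k =
    nut_off Omega phi df q dt v1 j k.
  by rewrite /nut_off /nu !alphaN !transportN.
rewrite /scheme_residual opprD -!sumrN; congr +%R; apply: eq_bigr => j _.
  by rewrite -opprD mulNr mulrN.
have nutN : nut Omega phi dfN q dt (opp v1) i j = nut Omega phi df q dt v1 i j.
  by rewrite /nut; case: ifP => _; [apply: eq_bigr => k _|]; rewrite off.
by rewrite transportN nutN mulrN.
Qed.

End Symmetry.

Unset Implicit Arguments.

Theorem theorem5p2 (R : realType) (d : nat) (hd : d = 2%N \/ d = 3%N)
  (Omega : set 'rV[R]_d)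
  (Omega_open : open Omega) (Omega_conn : connected Omega)
  (Omega_neq0 : Omega !=set0) (Omega_bnd : bounded_set Omega)
  (T : mesh R d) (T_conf : conforming_mesh T Omega)
  (phi : node T -> 'rV[R]_d -> R) (phi_basis : nodal_basis Omega phi)
  (f df : R -> 'rV[R]_d) (f_lip : exists L : R, L.-lipschitz f)
  (f_df : flux_derivative f df)
  (q : R) (q_gt0 : 0 < q)
  (N : nat) (t : nat -> R) (Tend : R)
  (t0 : t 0%N = 0) (tN : t N = Tend)
  (t_incr : forall n, (n < N)%N -> t n < t n.+1)
  (Gin : set ('rV[R]_d * R))
  (Gin_sub : forall y s, Gin (y, s) ->
     (closure Omega `\` interior Omega) y /\ 0 < s <= Tend)
  (ubar : 'rV[R]_d -> R -> R)
  (u : nat -> 'rV[R]_d -> R)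
  (u_Vh : forall n, (n <= N)%N -> fe_space T Omega (u n))
  (u_inflow : forall n (i : node T), (1 <= n <= N)%N -> Gin (pos i, t n) ->
     u n (pos i) = ubar (pos i) (t n))
  (u_scheme : forall n (i : node T), (n < N)%N -> ~ Gin (pos i, t n.+1) ->
     scheme_residual Omega phi df q (t n.+1 - t n) (u n) (u n.+1) i = 0) :
  forall n x, (1 <= n <= N)%N -> Omega x ->
    (ereal_inf (EFin @` Gamma_values N Omega Gin t u) <= (u n x)%:E
      <= ereal_sup (EFin @` Gamma_values N Omega Gin t u))%E.
Proof.
move=> n x /andP[_ nN] Ox.
have d0 : (0 < d)%N by case: hd => ->.
have [_ df_meas df_bnd] := f_df.
set G := Gamma_values _ _ _ _ _.
have initG y : Omega y -> G (u 0%N y) by move=> Oy; left; exists y.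
have inflowG m y : (1 <= m <= N)%N -> Gin (y, t m) -> G (u m y).
  by move=> mN my; right; exists m, y.
have upper b : (forall r, G r -> r <= b) -> u n x <= b.
  move=> hb; apply: (global_max d0 T_conf Omega_open Omega_bnd phi_basis
    df_meas df_bnd t_incr u_Vh u_scheme) => //.
    by move=> y /initG /hb.
  by move=> m y mN /(inflowG _ _ mN) /hb.
have lower b : (forall r, G r -> b <= r) -> b <= u n x.
  move=> hb; rewrite -lerN2.
  have dfN_meas k : measurable_fun [set: R] (fun s => df (- s) 0 k).
    by apply: (measurableT_comp (df_meas k)); exact: oppr_measurable.
  have dfN_bnd : exists C, forall s, `|df (- s)| <= C.
    by have [C hC] := df_bnd; exists C.
  apply: (global_max d0 T_conf Omega_open Omega_bnd phi_basis
    dfN_meas dfN_bnd t_incr (u := fun m y => - u m y) (Gin := Gin) (N := N)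
    (q := q)) => //.
  - by move=> m mN; exact: (fe_spaceN (u_Vh m mN)).
  - by move=> m i mN ni; rewrite residualN u_scheme// oppr0.
  - by move=> y /initG /hb; rewrite lerN2.
  - by move=> m y mN /(inflowG _ _ mN) /hb; rewrite lerN2.
have [y0 Oy0] := Omega_neq0.
have G0 : (EFin @` G) (u 0%N y0)%:E by exists (u 0%N y0) => //; exact: initG.
apply/andP; split.
  have lbG r : G r -> (ereal_inf (EFin @` G) <= r%:E)%E.
    by move=> Gr; apply: ereal_inf_lbound; exists r.
  have := ereal_inf_lbound G0.
  case: (ereal_inf _) lbG => [b lbG _| // |_ _]; last exact: leNye.
  by rewrite lee_fin; apply: lower => r /lbG; rewrite lee_fin.
have ubG r : G r -> (r%:E <= ereal_sup (EFin @` G))%E.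
  by move=> Gr; apply: ereal_sup_ubound; exists r.
have := ereal_sup_ubound G0.
case: (ereal_sup _) ubG => [b ubG _|_ _| //]; last exact: leey.
by rewrite lee_fin; apply: upper => r /ubG; rewrite lee_fin.
Qed.
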